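(* Let $\dot A$ be a densely defined closed symmetric operator with deficiency indices $(1,1)$ in a Hilbert space $\mathcal H$, let $\mathcal H_+\subset\mathcal H\subset\mathcal H_-$ be the rigged Hilbert space generated by $\dot A$, let $g_\pm\in\operatorname{Ker}(\dot A^*\mp iI)$ be $(+)$-normalized deficiency vectors, $\|g_\pm\|_+=1$, and set $\varphi=\mathcal R^{-1}g_+$, $\psi=\mathcal R^{-1}g_-$, where $\mathcal R$ is the Riesz-Berezansky operator. Suppose that $A$ is the self-adjoint extension of $\dot A$ such that $g_++g_-\in\mathrm{Dom}(A)$, and let $M_{(\dot A,A)}(z)$ be the Weyl-Titchmarsh function of the pair $(\dot A,A)$. Let $a>1$. Then the function $aM_{(\dot A,A)}(z)$ coincides with the impedance function of a unique L-system of the form $$\Theta_{1a}=\begin{pmatrix}\mathbb A_{1a}&K_{1a}&1\\ \mathcal H_+\subset\mathcal H\subset\mathcal H_-&&\mathbb C\end{pmatrix},$$ where $$\mathbb A_{1a}=\dot A^*-\tfrac i2\big(\cdot,(1-a)\varphi-(1+a)\psi\big)(\varphi+\psi),\qquad K_{1a}c=c\cdot\chi_{1a}\ (c\in\mathbb C),\qquad \chi_{1a}=\sqrt{\tfrac a2}\,(\varphi+\psi).$$ In this case the von Neumann parameter $\kappa$ of the main operator $T_{1a}$ of $\Theta_{1a}$ and the von Neumann parameter $U$ of the quasi-kernel $\hat A_{1a}=A$ of $\mathrm{Re}\,\mathbb A_{1a}$ are $$\kappa=\frac{a-1}{1+a}\quad\text{and}\quad U=1.$$ Moreover, if $\Theta$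 is an L-system with state-space operator $\mathbb A$, main operator $T$ and symmetric operator $\dot A$ such that $V_\Theta(z)=aM_{(\dot A,A)}(z)$ for $z\in\mathbb C_+$, where $A=\hat A$ is the quasi-kernel of $\mathrm{Re}\,\mathbb A$, then the von Neumann parameters $\kappa$ of $T$ and $U$ of $\hat A$ are $\kappa=\frac{a-1}{1+a}$ and $U=1$.
   Context: Inner products are linear in the first argument. $\mathbb C_\pm$ are the open upper and lower half-planes. Rigged space. For a closed densely defined symmetric $\dot A$ in $\mathcal H$, $\mathcal H_+=\mathrm{Dom}(\dot A^* )$ with $(f,g)_+=(f,g)+(\dot A^*f,\dot A^*g)$, and $\mathcal H_-$ is the corresponding negative space (dual of $\mathcal H_+$ with respect to the pairing extending the inner product of $\mathcal H$, also written $(\cdot,\cdot)$), so $\mathcal H_+\subset\mathcal H\subset\mathcal H_-$. The Riesz-Berezansky operator $\mathcal R$ is the isometric (linear) map of $\mathcal H_-$ onto $\mathcal H_+$ with $(f,g)=(f,\mathcal Rg)_+$ for $f\in\mathcal H_+$, $g\in\mathcal H_-$. $[\mathcal H_1,\mathcal H_2]$ denotes bounded linear operators. For $\mathbb A\in[\mathcal H_+,\mathcal H_-]$ the adjoint $\mathbb A^*\in[\mathcal H_+,\mathcal H_-]$ is taken with respect to the pairing; $\mathrm{Re}\,\mathbb A=\frac12(\mathbb A+\mathbb A^* )$, $\mathrm{Im}\,\mathbb A=\frac1{2i}(\mathbb A-\mathbb A^* )$. For $u,v\in\mathcal H_-$, $(\cdot,u)v$ denotes the operator $f\mapsto(f,u)v$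 from $\mathcal H_+$ to $\mathcal H_-$. Extensions. A quasi-self-adjoint extension of $\dot A$ is a non-symmetric operator $T$ in $\mathcal H$ with $\dot A\subset T\subset\dot A^*$. A self-adjoint bi-extension of $\dot A$ is $\mathbb B\in[\mathcal H_+,\mathcal H_-]$ with $\dot A\subset\mathbb B=\mathbb B^*$; its quasi-kernel is the restriction of $\mathbb B$ to $\{f\in\mathcal H_+:\mathbb Bf\in\mathcal H\}$; it is t-self-adjoint if its quasi-kernel is self-adjoint in $\mathcal H$. If $T$ is a quasi-self-adjoint extension of $\dot A$ with $\rho(T)\neq\emptyset$, a $( * )$-extension of $T$ is $\mathbb A\in[\mathcal H_+,\mathcal H_-]$ with $\mathbb A\supset T\supset\dot A$, $\mathbb A^*\supset T^*\supset\dot A$ and $\mathrm{Re}\,\mathbb A$ a t-self-adjoint bi-extension of $\dot A$. L-system. An array $\Theta=\begin{pmatrix}\mathbb A&K&1\\ \mathcal H_+\subset\mathcal H\subset\mathcal H_-&&\mathbb C\end{pmatrix}$ is an L-system if (1) $T$ is a dissipative ($\mathrm{Im}(Tf,f)\ge0$, $f\in\mathrm{Dom}(T)$) quasi-self-adjoint extension, with $\rho(T)\ne\emptyset$, of a symmetric operator $\dot A$ with deficiency indices $(1,1)$; (2) $\mathbb A$ is a $( * )$-extension of $T$; (3) $\mathrm{Im}\,\mathbb A=KK^*$ with $K\in[\mathbb C,\mathcal H_-]$, $K^*\in[\mathcal H_+,\mathbb C]$. Here $\dot A$, $T$, $\mathbb A$, $K$ are the symmetric, main, state-space and channel operators. Its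 impedance function is $V_\Theta(z)=K^*(\mathrm{Re}\,\mathbb A-zI)^{-1}K$ for nonreal $z\in\rho(T)$, extended analytically to all of $\mathbb C_\pm$. von Neumann parameters (with respect to the given $g_\pm$). For a dissipative quasi-self-adjoint extension $T$: the number $\kappa$, $|\kappa|<1$, with $g_+-\kappa g_-\in\mathrm{Dom}(T)$. For a self-adjoint extension $\hat A$: the number $U$, $|U|=1$, with $g_++Ug_-\in\mathrm{Dom}(\hat A)$. Weyl-Titchmarsh function: for a self-adjoint extension $A$ of $\dot A$, $M_{(\dot A,A)}(z)=((Az+I)(A-zI)^{-1}g,g)$, $z\in\mathbb C_+$, where $g\in\operatorname{Ker}(\dot A^*-iI)$ has $\|g\|=1$ in the norm of $\mathcal H$ (e.g. $g=\sqrt2\,g_+$ for $(+)$-normalized $g_+$). *)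

(* Defs.v *)
From HB Require Import structures.
From mathcomp Require Import all_boot all_order all_algebra sesquilinear.
From mathcomp Require Import complex.
From mathcomp Require Import boolp classical_sets functions reals topology.
From mathcomp Require Import normedtype derive.

Set Implicit Arguments.
Unset Strict Implicit.
Unset Printing Implicit Defensive.

Import Order.TTheory GRing.Theory Num.Theory.
Import numFieldNormedType.Exports.

Local Open Scope classical_set_scope.
Local Open Scope ring_scope.

Section DotForm.
Variables (C : numClosedFieldType) (U : lmodType C) (form : {dot U for @Num.conj C}).

Definition dot_norm (u : U) : C := sqrtC (form u u).

Lemma dot_norm_sqr u : dot_norm u ^+ 2 = form u u.
Proof. exact: sqrtCK. Qed.

Lemma dot_norm_ge0 u : 0 <= dot_norm u.
Proof. exact: sqrt_dnorm_ge0. Qed.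

Lemma dot_hermC u v : form u v = (form v u)^*.
Proof. by rewrite hermC /= expr0 mul1r. Qed.

Lemma dot_cauchy_schwarz u v : `|form u v| <= dot_norm u * dot_norm v.
Proof.
have [->|v0] := eqVneq v 0.
  by rewrite linear0r normr0 mulr_ge0 ?dot_norm_ge0.
have vv : 0 < form v v by rewrite dnorm_gt0.
rewrite -(ler_pXn2r (n := 2)) ?nnegrE ?mulr_ge0 ?dot_norm_ge0 //.
rewrite exprMn !dot_norm_sqr.
pose q := `|form u v| ^+ 2 / form v v.
have [c cE] : exists c, c = form u v / form v v by exists (form u v / form v v).
have vC : (form v v)^* = form v v by apply/CrealP; exact: gtr0_real.
have cq : c^* * form u v = q.
  by rewrite cE rmorphM /= fmorphV /= vC mulrAC [_^* * _]mulrC -normCK.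
have cc : `|c| ^+ 2 * form v v = q.
  by rewrite -cq normCK [c * _]mulrC -mulrA {2}cE divfK ?gt_eqF.
have qC : q^* = q by apply/CrealP; rewrite realM ?realV ?realX ?normr_real ?gtr0_real.
have := dnorm_ge0 form (u - c *: v).
rewrite dnormB dnormZ linearZr_LR /= cq cc qC opprD addrA addrK subr_ge0.
by rewrite ler_pdivrMr.
Qed.

Lemma ler_dot_normD u v : dot_norm (u + v) <= dot_norm u + dot_norm v.
Proof.
rewrite -(ler_pXn2r (n := 2)) ?nnegrE ?addr_ge0 ?dot_norm_ge0 //.
rewrite sqrrD !dot_norm_sqr dnormD [leRHS]addrAC lerD2l.
apply: (le_trans (real_ler_norm _)).
  by rewrite CrealE rmorphD /= conjCK addrC.
apply: (le_trans (ler_normD _ _)).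
by rewrite norm_conjC -mulr2n lerMn2r dot_cauchy_schwarz.
Qed.

Lemma dot_normZ (c : C) u : dot_norm (c *: u) = `|c| * dot_norm u.
Proof.
apply/(pexpIrn (n := 2)); rewrite ?nnegrE ?mulr_ge0 ?dot_norm_ge0 //.
by rewrite exprMn !dot_norm_sqr dnormZ.
Qed.

Lemma dot_norm0_eq0 u : dot_norm u = 0 -> u = 0.
Proof. by move/eqP; rewrite sqrt_dnorm_eq0 => /eqP. Qed.

End DotForm.

HB.mixin Record isHilbert (R : realType) H & CompleteNormedModule R[i] H := {
  inner : {dot H for @Num.conj R[i]};
  inner_normE : forall x : H, inner x x = `|x| ^+ 2 }.

#[short(type="hilbertType")]
HB.structure Definition Hilbert (R : realType) :=
  { H of isHilbert R H & CompleteNormedModule R[i] H }.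

Section BoundedOperators.
Variables (R : realType) (V W : normedModType R[i]).

Definition bounded_linear_pred : {pred V -> W} := fun B =>
  `[< linear B /\ exists M : R[i], forall f, `|B f| <= M * `|f| >].

Record bounded_op :=
  BoundedOp { bop_fun :> V -> W; _ : bop_fun \in bounded_linear_pred }.

HB.instance Definition _ := [isSub for bop_fun].
HB.instance Definition _ := [Choice of bounded_op by <:].

Lemma bounded_linear_submod_closed : submod_closed bounded_linear_pred.
Proof.
split.
  apply/asboolP; split; first by move=> c f g /=; rewrite scaler0 addr0.
  by exists 0 => f; rewrite mul0r normr0.
move=> a B D /asboolP[Bl [M BM]] /asboolP[Dl [N DN]]; apply/asboolP; split.
  move=> c f g; rewrite !fctE Bl Dl !scalerDr !scalerA [c * a]mulrC.
  by rewrite addrACA.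
exists (`|a| * M + N) => f; rewrite !fctE (le_trans (ler_normD _ _)) //.
by rewrite mulrDl lerD // normrZ -mulrA ler_wpM2l.
Qed.

HB.instance Definition _ :=
  GRing.isSubmodClosed.Build R[i] (V -> W) bounded_linear_pred
    bounded_linear_submod_closed.
HB.instance Definition _ := [SubChoice_isSubLmodule of bounded_op by <:].

Lemma bopP (B : bounded_op) : linear B.
Proof. by case: B => B /= /asboolP[]. Qed.

Lemma bop_bounded (B : bounded_op) :
  exists M : R[i], forall f, `|B f| <= M * `|f|.
Proof. by case: B => B /= /asboolP[]. Qed.

HB.instance Definition _ (B : bounded_op) :=
  GRing.isLinear.Build R[i] V W _ B (bopP B).

End BoundedOperators.

(* Operators in H are identified with their graphs, so extension is inclusion
   of sets and equality of operators is equality of sets. *)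
Section Operators.
Variables (R : realType) (H : hilbertType R).
Implicit Types (G T : set (H * H)) (z : R[i]).

Definition linear_operator G :=
  [/\ G (0, 0),
      forall (c : R[i]) p q, G p -> G q -> G (c *: p + q) &
      forall x y y', G (x, y) -> G (x, y') -> y = y'].

Definition opdom G : set H := [set x | exists y, G (x, y)].

Definition opval G (x : H) : H := xget 0 [set y | G (x, y)].

Definition adjoint G : set (H * H) :=
  [set p | forall x y, G (x, y) -> inner y p.1 = inner x p.2].

Definition symmetric_operator G := G `<=` adjoint G.

Definition self_adjoint G :=
  [/\ linear_operator G, dense (opdom G) & adjoint G = G].

Definition dissipative G :=
  forall x y, G (x, y) -> 0 <= 'Im (inner y x).

Definition resolvent G z (h : H) : H := xget 0 [set x | G (x, h + z *: x)].

Definition resolvent_set G : set R[i] :=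
  [set z | (forall h, exists! x, G (x, h + z *: x)) /\
    exists M : R[i], forall h, `|resolvent G z h| <= M * `|h|].

Record csym_operator := CSymOperator {
  csym_graph :> set (H * H);
  csym_linear : linear_operator csym_graph;
  csym_dense : dense (opdom csym_graph);
  csym_closed : closed csym_graph;
  csym_sym : symmetric_operator csym_graph }.

Definition has_dim (S : set H) (n : nat) :=
  exists e : 'I_n -> H,
    (forall x, S x <-> exists c : 'I_n -> R[i], x = \sum_i c i *: e i) /\
    (forall c : 'I_n -> R[i], \sum_i c i *: e i = 0 -> forall i, c i = 0).

(* Ker (G^* - z I) *)
Definition defect_space G z : set H := [set g | adjoint G (g, z *: g)].

Definition deficiency_indices G (m n : nat) :=
  has_dim (defect_space G 'i) m /\ has_dim (defect_space G (- 'i)) n.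

Lemma adjoint_linear G (c : R[i]) p q :
  adjoint G p -> adjoint G q -> adjoint G (c *: p + q).
Proof.
move=> Gp Gq x y Gxy /=.
by rewrite !linearDr !linearZr_LR /= (Gp _ _ Gxy) (Gq _ _ Gxy).
Qed.

Lemma adjoint0 G : adjoint G (0, 0).
Proof. by move=> x y _ /=; rewrite !linear0r. Qed.

Lemma dot_norm_inner (x : H) : dot_norm inner x = `|x|.
Proof. by rewrite /dot_norm inner_normE sqrCK. Qed.

Lemma inner_cauchy_schwarz (x y : H) : `|inner x y| <= `|x| * `|y|.
Proof. by rewrite -!dot_norm_inner dot_cauchy_schwarz. Qed.

Lemma adjoint_functional G : dense (opdom G) ->
  forall x y y', adjoint G (x, y) -> adjoint G (x, y') -> y = y'.
Proof.
move=> Gd x y y' Gy Gy'; apply/eqP; rewrite -subr_eq0; apply/negP => /negP d0.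
set d := y - y' in d0.
have [||w [/= dw [v Gwv]]] := Gd (ball d `|d|).
- by exists d; apply: ballxx; rewrite normr_gt0.
- exact: ball_open.
have wd : inner w d = 0.
  by rewrite /d linearBr /= -(Gy _ _ Gwv) -(Gy' _ _ Gwv) /= subrr.
have : inner d d = inner (d - w) d by rewrite [RHS]linearBl /= wd subr0.
rewrite inner_normE => dd.
have := inner_cauchy_schwarz (d - w) d.
rewrite -dd normrX normr_id expr2 ler_pM2r ?normr_gt0 //.
by move: dw; rewrite -ball_normE /= => /lt_geF ->.
Qed.

End Operators.

Section Rigging.
Variables (R : realType) (H : hilbertType R) (A : csym_operator H).

Definition hplus_pred : {pred H} := fun x => `[< opdom (adjoint A) x >].

Record Hplus := HPlus { hplus_val :> H; _ : hplus_val \in hplus_pred }.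

HB.instance Definition _ := [isSub for hplus_val].
HB.instance Definition _ := [Choice of Hplus by <:].

Lemma hplus_submod_closed : submod_closed hplus_pred.
Proof.
split; first by apply/asboolP; exists 0; exact: adjoint0.
move=> c x y /asboolP[x' Ax] /asboolP[y' Ay]; apply/asboolP.
by exists (c *: x' + y'); exact: (adjoint_linear c Ax Ay).
Qed.

HB.instance Definition _ :=
  GRing.isSubmodClosed.Build R[i] H hplus_pred hplus_submod_closed.
HB.instance Definition _ := [SubChoice_isSubLmodule of Hplus by <:].

Definition astar (f : Hplus) : H := opval (adjoint A) f.

Lemma astarP (f : Hplus) : adjoint A (f : H, astar f).
Proof.
have /asboolP[y Ay] := valP f.
exact: (xgetPex 0 (ex_intro (fun y => adjoint A (f : H, y)) y Ay)).
Qed.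

Lemma astarE (f : Hplus) y : adjoint A (f : H, y) -> astar f = y.
Proof. by apply: adjoint_functional (astarP f); exact: csym_dense. Qed.

Lemma astar_linear : linear astar.
Proof.
move=> c f g; apply: astarE.
exact: (adjoint_linear c (astarP f) (astarP g)).
Qed.

Definition plus_form (f g : Hplus) : R[i] :=
  inner (f : H) (g : H) + inner (astar f) (astar g).

Lemma plus_form_bilinear :
  bilinear_for *%R (@Num.conj R[i] \; *%R) plus_form.
Proof.
split=> [g c f f'|f c g g'].
  rewrite /plus_form astar_linear !linearDl !linearZl_LR /= mulrDr addrACA.
  by [].
rewrite /plus_form astar_linear !linearDr !linearZr_LR /= mulrDr addrACA.
by [].
Qed.

HB.instance Definition _ := bilinear_isBilinear.Build R[i] Hplus Hplus R[i]
  *%R (@Num.conj R[i] \; *%R) plus_form plus_form_bilinear.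

Lemma plus_form_herm (f g : Hplus) :
  plus_form f g = (-1) ^+ false * (plus_form g f)^*.
Proof.
rewrite expr0 mul1r /plus_form rmorphD /=.
by rewrite [inner (f : H) _]dot_hermC [inner (astar f) _]dot_hermC.
Qed.

HB.instance Definition _ := isHermitianSesquilinear.Build R[i] Hplus
  false (@Num.conj R[i]) plus_form plus_form_herm.

Lemma plus_form_gt0 (f : Hplus) : f != 0 -> 0 < plus_form f f.
Proof.
move=> f0; rewrite ltr_pwDl ?(dnorm_ge0 inner) //.
by apply: neq0_dnorm_gt0; apply: contra_neq f0 => f0; apply: val_inj.
Qed.

HB.instance Definition _ :=
  isDotProduct.Build R[i] Hplus plus_form plus_form_gt0.

HB.instance Definition _ := Lmodule_isNormed.Build R[i] Hplus
  (ler_dot_normD plus_form) (dot_normZ plus_form)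
  (@dot_norm0_eq0 _ _ plus_form).


Lemma plus_normE (f : Hplus) : `|f| = dot_norm plus_form f.
Proof. by []. Qed.

Lemma ler_plus_norm (f : Hplus) : `|f : H| <= `|f|.
Proof.
rewrite -(ler_pXn2r (n := 2)) ?nnegrE // plus_normE dot_norm_sqr -inner_normE.
by rewrite lerDl (dnorm_ge0 inner).
Qed.

Lemma ler_astar_norm (f : Hplus) : `|astar f| <= `|f|.
Proof.
rewrite -(ler_pXn2r (n := 2)) ?nnegrE // plus_normE dot_norm_sqr -inner_normE.
by rewrite lerDr (dnorm_ge0 inner).
Qed.

(* The element u of H_- is the bounded antilinear functional f |-> (u, f)
   on H_+. *)
Definition hminus_pred : {pred Hplus -> R[i]} := fun u =>
  `[< (forall (c : R[i]) f g, u (c *: f + g) = c^* * u f + u g) /\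
      exists M : R[i], forall f, `|u f| <= M * `|f| >].

Record Hminus :=
  HMinus { hminus_fun :> Hplus -> R[i]; _ : hminus_fun \in hminus_pred }.

HB.instance Definition _ := [isSub for hminus_fun].
HB.instance Definition _ := [Choice of Hminus by <:].

Lemma hminus_submod_closed : submod_closed hminus_pred.
Proof.
split.
  apply/asboolP; split; first by move=> c f g /=; rewrite mulr0 addr0.
  by exists 0 => f; rewrite mul0r normr0.
move=> a u v /asboolP[ul [M uM]] /asboolP[vl [N vN]]; apply/asboolP; split.
  move=> c f g; rewrite !fctE ul vl /GRing.scale /= !mulrDr addrACA.
  by congr (_ + _ + _); rewrite mulrCA.
exists (`|a| * M + N) => f; rewrite !fctE (le_trans (ler_normD _ _)) //.
by rewrite mulrDl lerD // /GRing.scale /= normrM -mulrA ler_wpM2l.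
Qed.

HB.instance Definition _ :=
  GRing.isSubmodClosed.Build R[i] (Hplus -> R[i]) hminus_pred
    hminus_submod_closed.
HB.instance Definition _ := [SubChoice_isSubLmodule of Hminus by <:].

Lemma hminusP (u : Hminus) (c : R[i]) f g : u (c *: f + g) = c^* * u f + u g.
Proof. by have /asboolP[ul _] := valP u; exact: ul. Qed.

Lemma hminus0 (u : Hminus) : u 0 = 0.
Proof.
have := hminusP u 1 0 0; rewrite scaler0 addr0 rmorph1 mul1r => u00.
by apply: (addrI (u 0)); rewrite -u00 addr0.
Qed.

Lemma hminusZ (u : Hminus) (c : R[i]) f : u (c *: f) = c^* * u f.
Proof. by have := hminusP u c f 0; rewrite hminus0 !addr0. Qed.

Lemma hminus_bounded (u : Hminus) :
  exists M : R[i], forall f, `|u f| <= M * `|f|.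
Proof. by have /asboolP[] := valP u. Qed.

Definition minus_normR (u : Hminus) : R :=
  sup [set complex.Re `|u f| | f in [set f : Hplus | `|f| <= 1]].

Definition minus_norm (u : Hminus) : R[i] := real_complex R (minus_normR u).

Lemma norm_Re (x : R[i]) : real_complex R (complex.Re `|x|) = `|x|.
Proof. by rewrite normc_def. Qed.

Lemma minus_norm_has_sup (u : Hminus) :
  has_sup [set complex.Re `|u f| | f in [set f : Hplus | `|f| <= 1]].
Proof.
split; first by exists (complex.Re `|u 0|), 0 => //=; rewrite normr0.
have [M uM] := hminus_bounded u.
exists (complex.Re `|M|) => _ [f /= f1 <-]; rewrite -lecR !norm_Re.
apply: (le_trans (real_ler_norm _)); first exact: normr_real.
rewrite normr_id; apply: (le_trans (uM f)).
apply: (le_trans (real_ler_norm _)).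
  by apply: ger0_real; apply: le_trans (uM f).
by rewrite normrM normr_id ler_piMr.
Qed.

Lemma ler_minus_norm (u : Hminus) (f : Hplus) : `|u f| <= minus_norm u * `|f|.
Proof.
have [->|f0] := eqVneq f 0; first by rewrite hminus0 !normr0 mulr0.
have nf : 0 < `|f| by rewrite normr_gt0.
have nfi : `|f|^-1 \is Num.real by rewrite realV normr_real.
rewrite -ler_pdivrMr // /minus_norm.
have -> : `|u f| / `|f| = `|u (`|f|^-1 *: f)|.
  by rewrite hminusZ normrM (CrealP nfi) normfV normr_id mulrC.
rewrite -norm_Re lecR; apply: (ub_le_sup (minus_norm_has_sup u).2).
by exists (`|f|^-1 *: f) => //=; rewrite normrZ normfV normr_id mulVf ?gt_eqF.
Qed.

Lemma minus_norm_le (u : Hminus) (M : R) :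
  (forall f, `|f| <= 1 -> `|u f| <= real_complex R M) -> minus_normR u <= M.
Proof.
move=> uM; apply: ge_sup; first exact: (minus_norm_has_sup u).1.
by move=> _ [f /= f1 <-]; rewrite -lecR norm_Re; exact: uM.
Qed.

Lemma minus_norm_ge0 u : 0 <= minus_norm u.
Proof.
rewrite -(rmorph0 (real_complex R)) lecR.
apply: (ub_le_sup (minus_norm_has_sup u).2).
exists 0; first by rewrite /= normr0.
by rewrite hminus0 normr0.
Qed.

Lemma ler_minus_normD u v : minus_norm (u + v) <= minus_norm u + minus_norm v.
Proof.
rewrite -rmorphD lecR; apply: minus_norm_le => f f1.
rewrite /= fctE (le_trans (ler_normD _ _)) // rmorphD lerD //.
  by rewrite (le_trans (ler_minus_norm u f)) // ler_piMr // minus_norm_ge0.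
by rewrite (le_trans (ler_minus_norm v f)) // ler_piMr // minus_norm_ge0.
Qed.

Lemma minus_norm_eq0 u : minus_norm u = 0 -> u = 0.
Proof.
move=> u0; apply/val_inj/funext => f; apply/eqP; rewrite -normr_le0 /=.
by rewrite (le_trans (ler_minus_norm u f)) // u0 mul0r.
Qed.

Lemma minus_normZ_le (c : R[i]) u : minus_norm (c *: u) <= `|c| * minus_norm u.
Proof.
rewrite -norm_Re -rmorphM lecR; apply: minus_norm_le => f f1.
rewrite /= fctE /GRing.scale /= normrM rmorphM /= norm_Re ler_wpM2l //.
by rewrite (le_trans (ler_minus_norm u f)) // ler_piMr // minus_norm_ge0.
Qed.

Lemma minus_normZ (c : R[i]) u : minus_norm (c *: u) = `|c| * minus_norm u.
Proof.
apply/eqP; rewrite eq_le minus_normZ_le /=.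
have [->|c0] := eqVneq c 0.
  by rewrite normr0 mul0r minus_norm_ge0.
rewrite -ler_pdivlMl ?normr_gt0 // -normfV -{1}(scalerK c0 u).
exact: minus_normZ_le.
Qed.

HB.instance Definition _ := Lmodule_isNormed.Build R[i] Hminus
  ler_minus_normD minus_normZ minus_norm_eq0.

End Rigging.

Section LSystems.
Variables (R : realType) (H : hilbertType R) (A : csym_operator H).
Implicit Types (f g : Hplus A) (u v : Hminus A) (T : set (H * H)) (z : R[i]).

(* (f, u) *)
Definition pairing f u : R[i] := (u f)^*.

Lemma embed_subproof (h : H) :
  (fun f : Hplus A => inner h (f : H)) \in @hminus_pred R H A.
Proof.
apply/asboolP; split; first by move=> c f g; rewrite linearDr linearZr_LR.
exists `|h| => f; rewrite (le_trans (inner_cauchy_schwarz _ _)) //.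
by rewrite ler_wpM2l // ler_plus_norm.
Qed.

Definition embed (h : H) : Hminus A := HMinus (embed_subproof h).

Lemma minus_norm_leC u (M : R[i]) :
  (forall f, `|u f| <= M * `|f|) -> `|u| <= `|M|.
Proof.
move=> uM; rewrite -[leRHS]norm_Re lecR; apply: minus_norm_le => f f1.
rewrite norm_Re; apply: (le_trans (uM f)).
apply: (le_trans (real_ler_norm _)).
  by apply: ger0_real; apply: le_trans (uM f).
by rewrite normrM normr_id ler_piMr.
Qed.

Lemma star_op_subproof :
  (fun f => embed (astar f)) \in
    @bounded_linear_pred R (Hplus A) (Hminus A).
Proof.
apply/asboolP; split.
  move=> c f g; apply/val_inj/funext => k.
  by rewrite /= astar_linear linearDl linearZl_LR.
exists 1 => f; rewrite mul1r (le_trans _ (ler_astar_norm f)) //.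
rewrite -[leRHS]normr_id; apply: minus_norm_leC => g.
rewrite (le_trans (inner_cauchy_schwarz _ _)) //.
by rewrite ler_wpM2l // ler_plus_norm.
Qed.

(* A^* as an element of [H_+, H_-] *)
Definition star_op : bounded_op (Hplus A) (Hminus A) :=
  BoundedOp star_op_subproof.

Lemma rank1_subproof u v :
  (fun f => pairing f u *: v) \in @bounded_linear_pred R (Hplus A) (Hminus A).
Proof.
apply/asboolP; split.
  move=> c f g; rewrite /pairing hminusP rmorphD rmorphM /= conjCK.
  by rewrite scalerDl scalerA.
exists (`|u| * `|v|) => f; rewrite normrZ norm_conjC mulrAC ler_wpM2r //.
exact: ler_minus_norm.
Qed.

(* (., u) v *)
Definition rank1 u v : bounded_op (Hplus A) (Hminus A) :=
  BoundedOp (rank1_subproof u v).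

Section Adjoint.
Variable B : bounded_op (Hplus A) (Hminus A).

Lemma bop_form_bounded :
  exists2 M : R[i], 0 <= M & forall f g, `|B f g| <= M * `|f| * `|g|.
Proof.
have [M BM] := bop_bounded B; exists `|M| => // f g.
rewrite (le_trans (ler_minus_norm (B f) g)) // ler_wpM2r //.
apply: (le_trans (BM f)); apply: (le_trans (real_ler_norm _)).
  by apply: ger0_real; apply: le_trans (BM f).
by rewrite normrM normr_id.
Qed.

Lemma adj_fun_subproof g : (fun f => (B f g)^*) \in @hminus_pred R H A.
Proof.
have [M M0 BM] := bop_form_bounded.
apply/asboolP; split.
  move=> c f f'; rewrite linearP /= !fctE /GRing.scale /= rmorphD rmorphM.
  by [].
by exists (M * `|g|) => f; rewrite norm_conjC mulrAC.
Qed.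

Lemma adj_op_subproof :
  (fun g => HMinus (adj_fun_subproof g)) \in
    @bounded_linear_pred R (Hplus A) (Hminus A).
Proof.
have [M M0 BM] := bop_form_bounded.
apply/asboolP; split.
  move=> c g g'; apply/val_inj/funext => f.
  by rewrite /= !fctE /GRing.scale /= hminusP rmorphD rmorphM /= conjCK.
exists M => g; rewrite -[leRHS]ger0_norm ?mulr_ge0 //.
apply: minus_norm_leC => f /=.
by rewrite norm_conjC mulrAC.
Qed.

Definition adj_op : bounded_op (Hplus A) (Hminus A) :=
  BoundedOp adj_op_subproof.

Lemma adj_opP f g : B f g = pairing f (adj_op g).
Proof. by rewrite /pairing /= conjCK. Qed.

Definition re_op : bounded_op (Hplus A) (Hminus A) := 2^-1 *: (B + adj_op).

Definition im_op : bounded_op (Hplus A) (Hminus A) :=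
  (2 * 'i)^-1 *: (B - adj_op).

End Adjoint.

Lemma channel_of_subproof u :
  (fun c : R[i]^o => c *: u) \in @bounded_linear_pred R R[i]^o (Hminus A).
Proof.
apply/asboolP; split; first by move=> c d e; rewrite scalerDl scalerA.
by exists `|u| => c; rewrite normrZ mulrC.
Qed.

Definition channel_of u : bounded_op R[i]^o (Hminus A) :=
  BoundedOp (channel_of_subproof u).

Section ChannelAdjoint.
Variable K : bounded_op R[i]^o (Hminus A).

Lemma channel_adj_subproof :
  (fun f => pairing f (K 1)) \in @bounded_linear_pred R (Hplus A) R[i]^o.
Proof.
apply/asboolP; split.
  by move=> c f g; rewrite /pairing hminusP rmorphD rmorphM /= conjCK.
by exists `|K 1| => f; rewrite norm_conjC; exact: ler_minus_norm.
Qed.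

Definition channel_adj : bounded_op (Hplus A) R[i]^o :=
  BoundedOp channel_adj_subproof.

(* (K c, f) = (c, K^* f) *)
Lemma channel_adjP (c : R[i]) f : K c f = c * (channel_adj f)^*.
Proof.
have -> : K c = c *: K 1 by rewrite -linearZ /GRing.scale /= mulr1.
by rewrite /= /pairing conjCK fctE.
Qed.

End ChannelAdjoint.

Record riesz_berezansky (Rz : Hminus A -> Hplus A) : Prop := RieszBerezansky {
  rb_linear : linear Rz;
  rb_isometric : forall u, `|Rz u| = `|u|;
  rb_onto : forall f, exists u, Rz u = f;
  rb_pairing : forall f u, pairing f u = plus_form f (Rz u) }.

Definition bop_extends (B : bounded_op (Hplus A) (Hminus A)) T :=
  forall x y, T (x, y) -> exists f : Hplus A, (f : H) = x /\ B f = embed y.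

Definition quasi_kernel (B : bounded_op (Hplus A) (Hminus A)) : set (H * H) :=
  [set p | exists f : Hplus A, (f : H) = p.1 /\ B f = embed p.2].

Definition self_adjoint_biextension (B : bounded_op (Hplus A) (Hminus A)) :=
  bop_extends B A /\ adj_op B = B.

Definition t_self_adjoint_biextension
    (B : bounded_op (Hplus A) (Hminus A)) :=
  self_adjoint_biextension B /\ self_adjoint (quasi_kernel B).

Definition quasi_self_adjoint_extension T :=
  [/\ linear_operator T, csym_graph A `<=` T, T `<=` adjoint A &
      ~ symmetric_operator T].

Definition star_extension T (B : bounded_op (Hplus A) (Hminus A)) :=
  [/\ quasi_self_adjoint_extension T /\ resolvent_set T !=set0,
      bop_extends B T /\ csym_graph A `<=` T,
      bop_extends (adj_op B) (adjoint T) /\ csym_graph A `<=` adjoint T &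
      t_self_adjoint_biextension (re_op B)].

Record lsystem := LSystem {
  main_op : set (H * H);
  state_op : bounded_op (Hplus A) (Hminus A);
  channel_op : bounded_op R[i]^o (Hminus A);
  lsys_deficiency : deficiency_indices A 1 1;
  lsys_quasi_self_adjoint : quasi_self_adjoint_extension main_op;
  lsys_dissipative : dissipative main_op;
  lsys_resolvent : resolvent_set main_op !=set0;
  lsys_star : star_extension main_op state_op;
  lsys_im : forall f, im_op state_op f = channel_op (channel_adj channel_op f) }.

(* w is the value at z of K^* (Re A - z I)^-1 K, as a multiplication operator
   on C. *)
Definition impedance_at (Th : lsystem) z (w : R[i]) :=
  exists f : Hplus A,
    unique (fun f => re_op (state_op Th) f - z *: embed f = channel_op Th 1) f /\
    w = channel_adj (channel_op Th) f.

(* The quasi-kernel of Re A being self-adjoint, the inverse above makes sense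
   at every nonreal z, also outside the resolvent set of the main operator,
   and is analytic there: the formula itself provides the analytic extension.
   This matters since the resolvent set of a dissipative main operator may be
   disjoint from the upper half-plane, in which case analyticity alone does not
   determine the extension.  V is unconstrained on the real axis. *)
Definition is_impedance (Th : lsystem) (V : R[i]^o -> R[i]^o) :=
  forall z, 'Im z != 0 -> impedance_at Th z (V z) /\ derivable V z 1.

Definition impedance_coincides (Th : lsystem) (F : R[i] -> R[i]) :=
  exists2 V, is_impedance Th V & forall z, 0 < 'Im z -> V z = F z.

Definition von_neumann_main (gp gm : H) T (k : R[i]) :=
  unique (fun k => `|k| < 1 /\ opdom T (gp - k *: gm)) k.

Definition von_neumann_self_adjoint (gp gm : H) T (U : R[i]) :=
  unique (fun U => `|U| = 1 /\ opdom T (gp + U *: gm)) U.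

End LSystems.

(* ((A z + I) (A - z I)^-1 g, g) *)
Definition weyl_titchmarsh (R : realType) (H : hilbertType R)
    (G : set (H * H)) (g : H) (z : R[i]) : R[i] :=
  let f := resolvent G z g in inner (z *: opval G f + f) g.

(* Main.v *)
(* With [al f = (f, g_+)_+] and [be f = (f, g_-)_+], Green's identity
   [(A^* f, k) - (f, A^* k) = i (al f (al k)^bar - be f (be k)^bar)] reduces
   everything to linear algebra in the two coordinates [al] and [be]: [A] is
   [{al = be}], and [A_1a] has quasi-kernel [{(1 - a) al = (1 + a) be}], which
   is the main operator.  Since [phi + psi] is not in [H], the equation
   [(Re A_1a - z) f = chi_1a] says that [A^* f = z f] and that [al f - be f] is
   prescribed; its solution is a multiple of [g + (z - i) (A - z)^-1 g], whence
   [V = a M] in both half-planes.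

   Conversely, a self-adjoint bi-extension with quasi-kernel [A] has the form
   [A^* + (al - be) omega], [omega = c phi - c^bar psi], [Im c = -1/2].  The
   impedance at the single point [z = i], where [M(i) = i], already forces
   [K 1] to be a multiple of [omega] and [c = -i/2], so that the state-space
   operator is [A_1a]. *)

From HB Require Import structures.
Require Import Defs.
From mathcomp Require Import all_boot all_order all_algebra sesquilinear.
From mathcomp Require Import complex ring interval_inference.
From mathcomp Require Import boolp classical_sets functions reals topology.
From mathcomp Require Import normedtype derive.

Set Implicit Arguments.
Unset Strict Implicit.
Unset Printing Implicit Defensive.

Import Order.TTheory GRing.Theory Num.Theory.
Import numFieldNormedType.Exports.

Local Open Scope classical_set_scope.
Local Open Scope ring_scope.

(** * Resolvents of operators in a Hilbert space *)

Section HilbertSpace.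
Variables (R : realType) (H : hilbertType R).
Implicit Types (G T : set (H * H)) (x y h : H) (z : R[i]).

Lemma innerDl x y h : inner (x + y) h = inner x h + inner y h.
Proof. exact: linearDl. Qed.

Lemma innerBl x y h : inner (x - y) h = inner x h - inner y h.
Proof. exact: linearBl. Qed.

Lemma innerBr x y h : inner h (x - y) = inner h x - inner h y.
Proof. exact: linearBr. Qed.

Lemma innerZl (c : R[i]) x h : inner (c *: x) h = c * inner x h.
Proof. exact: linearZl_LR. Qed.

Lemma innerZr (c : R[i]) x h : inner h (c *: x) = c^* * inner h x.
Proof. by rewrite linearZr_LR. Qed.

Lemma inner0r x : inner x 0 = 0.
Proof. exact: linear0r. Qed.

Lemma innerE x : inner x x = (complex.Re `|x| ^+ 2)%:C%C.
Proof. by rewrite inner_normE rmorphXn /= RRe_real ?normr_real. Qed.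

(* Approximate orthogonal projection: an almost minimizer of the distance from
   [h] to [S].  [S] is not assumed to be closed. *)
Lemma inner_near_orthogonal (S : set H) h (e : R) : S 0 ->
  (forall (c : R[i]) p q, S p -> S q -> S (c *: p + q)) -> 0 < e ->
  exists2 q, S q & forall s, S s -> `|inner (h - q) s| <= e%:C%C * `|s|.
Proof.
move=> S0 Slin e0; pose E := [set complex.Re `|h - q| ^+ 2 | q in S].
have Elb : has_lbound E by exists 0 => _ [q _ <-]; exact: sqr_ge0.
have Einf : has_inf E by split=> //; exists (complex.Re `|h - 0| ^+ 2), 0.
have e2 : 0 < e ^+ 2 by rewrite exprn_gt0.
have [_ [q Sq <-] qlt] := inf_adherent e2 Einf.
exists q => // s Ss; have [->|s0] := eqVneq s 0.
  by rewrite inner0r !normr0 mulr0.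
have ss : 0 < inner s s by rewrite dnorm_gt0.
have ssC : (inner s s)^* = inner s s by apply/CrealP; exact: gtr0_real.
(* Moving [q] by the best multiple [c] of [s] lowers the squared distance by [|d| ^ 2 / (s, s)],
   which is below [e ^ 2] because [q] is within [e ^ 2] of the infimum. *)
pose d := inner (h - q) s; pose c := d / inner s s.
have /(ge_inf Elb) infle : E (complex.Re `|h - (c *: s + q)| ^+ 2).
  by exists (c *: s + q) => //; exact: Slin.
have : inner (h - q) (h - q) <
    inner (h - q - c *: s) (h - q - c *: s) + (e ^+ 2)%:C%C.
  have -> : h - q - c *: s = h - (c *: s + q) by rewrite opprD addrCA addrC.
  rewrite !innerE -(rmorphD (real_complex R)) ltcR.
  by rewrite (lt_le_trans qlt) // lerD2r.
rewrite [inner (_ - _ *: _) _]dnormB dnormZ linearZr_LR /= -/d.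
have cc : `|c| ^+ 2 * inner s s = `|d| ^+ 2 / inner s s.
  rewrite /c normrM normfV exprMn [`|inner s s|]gtr0_norm //.
  by rewrite exprVn; field; rewrite gt_eqF.
have cd : c^* * d = `|d| ^+ 2 / inner s s.
  by rewrite /c rmorphM /= fmorphV /= ssC normCK mulrAC [_^* * _]mulrC.
have qC : (`|d| ^+ 2 / inner s s)^* = `|d| ^+ 2 / inner s s.
  apply/CrealP; rewrite realM ?realV ?realX ?normr_real //.
  exact: gtr0_real.
rewrite cc cd qC opprD !addrA addrK -addrA ltrDl addrC subr_gt0.
rewrite ltr_pdivrMr // => dlt; rewrite -(ler_pXn2r (n := 2)) ?nnegrE //.
  by rewrite exprMn -(inner_normE s) ltW //; move: dlt; rewrite rmorphXn.
by rewrite mulr_ge0 // -(rmorph0 (real_complex R)) lecR ltW.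
Qed.

Lemma normr_Im_le (w : R[i]) : `|'Im w| <= `|w|.
Proof.
rewrite -(ler_pXn2r (n := 2)) ?nnegrE // [leRHS]normC2_Re_Im real_normK
  ?Creal_Im //.
by rewrite lerDr -realEsqr Creal_Re.
Qed.

(** In [Im (y - z x, x) = Im (y, x) - Im z |x|^2] the two terms have the same sign, so the second
    bounds the modulus from below; then Cauchy-Schwarz. It serves symmetric operators at every [z]
    and dissipative ones in the lower half-plane. *)
Lemma coercive_below x y z : 'Im z * 'Im (inner y x) <= 0 ->
  `|'Im z| * `|x| <= `|y - z *: x|.
Proof.
move=> zyx; have [->|x0] := eqVneq x 0; first by rewrite normr0 mulr0.
have [->|z0] := eqVneq ('Im z) 0; first by rewrite normr0 mul0r.
rewrite -(ler_pM2r (x := `|x|)) ?normr_gt0 //.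
apply: le_trans (inner_cauchy_schwarz _ _); apply: le_trans (normr_Im_le _).
rewrite -(ler_pM2l (x := `|'Im z|)) ?normr_gt0 // -[leRHS]normrM.
rewrite innerBl innerZl inner_normE raddfB /= ImM.
have xR : `|x| ^+ 2 \is Num.real by rewrite realX ?normr_real.
rewrite (Creal_ReP _ xR) (Creal_ImP _ xR) mulr0 add0r.
rewrite -[leRHS]normrN; apply: le_trans (real_ler_norm _); last first.
  by rewrite realN realM ?realB ?realM ?Creal_Im.
have -> : `|'Im z| * (`|'Im z| * `|x| * `|x|) = `|'Im z| ^+ 2 * `|x| ^+ 2.
  by ring.
rewrite real_normK ?Creal_Im //; set m := 'Im z; set b := 'Im _.
have -> : - (m * (b - `|x| ^+ 2 * m)) = m ^+ 2 * `|x| ^+ 2 - m * b by ring.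
by rewrite lerDl oppr_ge0.
Qed.

Lemma symmetric_inner_real G x y : symmetric_operator G -> G (x, y) ->
  'Im (inner y x) = 0.
Proof.
move=> Gsym Gxy; have /= yx := Gsym _ Gxy _ _ Gxy.
by apply/Creal_ImP/CrealP; rewrite -dot_hermC yx.
Qed.

Lemma symmetric_below G z x y : symmetric_operator G -> G (x, y) ->
  `|'Im z| * `|x| <= `|y - z *: x|.
Proof.
move=> Gsym Gxy; apply: coercive_below.
by rewrite (symmetric_inner_real Gsym Gxy) mulr0.
Qed.

(** Each pair of [G] imposes one equation, continuous in the pair tested; the proof is the
    corresponding explicit estimate. *)
Lemma closed_adjoint G : closed (adjoint G).
Proof.
move=> p pcl x y Gxy; apply/eqP; rewrite -subr_eq0 -normr_le0.
set d := `|_|; have d0 : 0 <= d by exact: normr_ge0.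
(* The summand [1] keeps the divisor positive even when [x = y = 0]. *)
have M0 : 0 < `|x| + `|y| + 1 by rewrite ltr_wpDl // addr_ge0.
apply/ler_addgt0Pl => e e0; rewrite addr0.
have [q [Gq pq]] := pcl _ (nbhsx_ballx p (e / (`|x| + `|y| + 1)) (divr_gt0 e0
  M0)).
have := Gq _ _ Gxy => yq.
have dE : d = `|inner y (p.1 - q.1) - inner x (p.2 - q.2)|.
  by rewrite /d !innerBr yq; congr (`|_|); ring.
rewrite dE (le_trans (ler_normB _ _)) //.
have /andP[p1 p2] : (`|p.1 - q.1| < e / (`|x| + `|y| + 1)) &&
    (`|p.2 - q.2| < e / (`|x| + `|y| + 1)).
  by move: pq => []; rewrite -!ball_normE /= => -> ->.
apply: (@le_trans _ _ ((`|x| + `|y|) * (e / (`|x| + `|y| + 1)))).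
  rewrite mulrDl addrC lerD // (le_trans (inner_cauchy_schwarz _ _)) //.
    by rewrite ler_wpM2l // ltW.
  by rewrite ler_wpM2l // ltW.
rewrite mulrCA ler_piMr ?(ltW e0) // ler_pdivrMr // mul1r.
by rewrite lerDl.
Qed.

Lemma gtc0_real_complex (e : R[i]) : 0 < e -> exists2 r : R, 0 < r & e = r%:C%C.
Proof.
move=> e0; exists (complex.Re e); last by rewrite RRe_real ?gtr0_real.
by move: e0; rewrite ltcE => /andP[].
Qed.

Lemma cvgn_natSinv_rate (u : nat -> H) (k : R) :
  (forall n m, `|u n - u m| <= (k * (n.+1%:R^-1 + m.+1%:R^-1))%:C%C) ->
  exists l : H, u @ \oo --> l.
Proof.
move=> uk; apply/(cvg_ex (u @ \oo))/cauchy_cvgP/cauchy_exP => e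
  /gtc0_real_complex[r r0 ->].
have K0 : 0 < `|k| + 1 by rewrite ltr_wpDl.
have d0 : 0 < r / 2 / (`|k| + 1) by rewrite !divr_gt0.
have small : \forall n \near \oo, n.+1%:R^-1 < r / 2 / (`|k| + 1).
  exact: (near_infty_natSinv_lt (PosNum d0)).
have [N _ smallN] := small; exists (u N); exists N => // n Nn.
rewrite -ball_normE /= (le_lt_trans (uk _ _)) // ltcR.
apply: (@le_lt_trans _ _ ((`|k| + 1) * (N.+1%:R^-1 + n.+1%:R^-1))).
  rewrite ler_wpM2r ?addr_ge0 ?invr_ge0 //.
  by rewrite (le_trans (ler_norm _)) // lerDl.
by rewrite mulrC -ltr_pdivlMr // [r]splitr mulrDl ltrD // smallN /=.
Qed.

(* [n] is the component orthogonal to the range of [G - z], which is closed by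
   the lower bound. *)
Lemma range_decomposition G (c : R) z h : linear_operator G -> closed G ->
  0 < c -> (forall x y, G (x, y) -> c%:C%C * `|x| <= `|y - z *: x|) ->
  exists x y n, [/\ G (x, y), h = y - z *: x + n & adjoint G (n, z^* *: n)].
Proof.
move=> [G0 Glin _] Gcl c0 Gz.
pose S := [set p.2 - z *: p.1 | p in G].
have S0 : S 0 by exists (0, 0); rewrite //= scaler0 subr0.
have Slin (b : R[i]) p q : S p -> S q -> S (b *: p + q).
  move=> [s Gs <-] [t Gt <-]; exists (b *: s + t); first exact: Glin.
  by rewrite /= scalerDr !scalerBr opprD !scalerA mulrC addrACA.
have e0 n : 0 < n.+1%:R^-1 :> R by [].
have /choice[w wP] n : exists w : H * H, G w /\
    forall s, S s -> `|inner (h - (w.2 - z *: w.1)) s| <= (n.+1%:R^-1)%:C%C *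
      `|s|.
  have [_ [w Gw <-] wS] := inner_near_orthogonal h S0 Slin (e0 n).
  by exists w.
have [v vE] : exists v : nat -> H, forall n, v n = (w n).2 - z *: (w n).1.
  by exists (fun n => (w n).2 - z *: (w n).1).
have Sv n : S (v n) by exists (w n) => //; case: (wP n).
have vS n t : S t -> `|inner (h - v n) t| <= (n.+1%:R^-1)%:C%C * `|t|.
  by rewrite vE; exact: (wP n).2.
have SvB n m : S (v n - v m).
  by rewrite addrC -scaleN1r; exact: Slin.
(* [v n - v m] lies in the range and is also the difference of two residuals, each almost orthogonal
   to the range; pairing it with itself gives the bound. *)
have vB n m : `|v n - v m| <= (n.+1%:R^-1 + m.+1%:R^-1)%:C%C.
  have [->|d0] := eqVneq (v n - v m) 0.
    by rewrite normr0 -(rmorph0 (real_complex R)) lecR addr_ge0.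
  rewrite -(ler_pM2r (x := `|v n - v m|)) ?normr_gt0 // -expr2 -inner_normE.
  have dE : v n - v m = (h - v m) - (h - v n).
    by rewrite opprB [RHS]addrC subrKA.
  rewrite -(ger0_norm (dnorm_ge0 inner _)) {1}dE innerBl.
  rewrite (le_trans (ler_normB _ _)) // rmorphD mulrDl addrC.
  by rewrite lerD // vS.
have [vl vlP] : exists l : H, v @ \oo --> l.
  by apply: (@cvgn_natSinv_rate _ 1) => n m; rewrite mul1r.
(* The lower bound on [G - z] carries the Cauchy property from the images [v n] back to the
   preimages. *)
have [xl xlP] : exists l : H, (w n).1 @[n --> \oo] --> l.
  apply: (@cvgn_natSinv_rate _ c^-1) => n m.
  rewrite rmorphM /= -(ler_pM2l (x := c%:C%C)) ?ltcR // mulrA -rmorphM /=.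
  rewrite mulfV ?gt_eqF // mul1r (le_trans _ (vB n m)) //.
  have -> : v n - v m = ((w n).2 - (w m).2) - z *: ((w n).1 - (w m).1).
    by rewrite scalerBr !vE !opprB addrACA [RHS]addrACA; congr (_ + _);
      rewrite addrC.
  apply: Gz; have := Glin (-1) _ _ (wP m).1 (wP n).1.
  by rewrite scaleN1r addrC.
have Gl : G (xl, vl + z *: xl).
  apply: (@closed_cvg _ _ \oo _ (fun n => ((w n).1, v n + z *: (w n).1)) G) =>
    //.
    by apply: nearW => n; rewrite vE subrK -surjective_pairing; exact: (wP n).1.
  by apply: cvg_pair => //=; apply: cvgD => //; exact: cvgZr.
exists xl, (vl + z *: xl), (h - vl); split=> //.
  by rewrite addrK subrKC.
(* The claim becomes orthogonality of [h - vl] to every [s] in the range, the limit of the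
   approximate orthogonality of [h - v n]. *)
move=> a b Gab; apply/eqP; rewrite -subr_eq0 innerZr conjCK -innerZl -innerBl.
set s := b - z *: a; have Ss : S s by exists (a, b).
rewrite dot_hermC conjC_eq0 -normr_le0; apply/ler_addgt0Pl => e e1.
rewrite addr0; have M0 : 0 < `|s| + `|s| + 1 by rewrite ltr_wpDl // addr_ge0.
have [r r0 rE] := gtc0_real_complex (divr_gt0 e1 M0).
have /cvgrPdist_lt/(_ _ (divr_gt0 e1 M0)) vcl := vlP.
near \oo => n.
have -> : h - vl = (h - v n) - (vl - v n) by rewrite opprB addrA subrK.
rewrite innerBl (le_trans (ler_normB _ _)) //.
apply: (@le_trans _ _ (r%:C%C * `|s| + r%:C%C * `|s|)).
  rewrite lerD //.
    rewrite (le_trans (vS n _ Ss)) // ler_wpM2r // lecR ltW //.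
    by near: n; exact: (near_infty_natSinv_lt (PosNum r0)).
  rewrite (le_trans (inner_cauchy_schwarz _ _)) // ler_wpM2r // -rE ltW //.
  by near: n.
rewrite -rE -mulrDr mulrAC ler_pdivrMr // ler_pM2l //.
by rewrite lerDl.
Unshelve. all: by end_near. Qed.

End HilbertSpace.

(** * Resolvents of self-adjoint operators and the Weyl-Titchmarsh function *)

Section SelfAdjoint.
Variables (R : realType) (H : hilbertType R) (A : set (H * H)).
Hypothesis A_sa : self_adjoint A.
Implicit Types (x y h : H) (z : R[i]).

Lemma self_adjoint_symmetric : symmetric_operator A.
Proof. by case: A_sa => _ _ AE p; rewrite AE. Qed.

Lemma self_adjoint_subr x y x' y' : A (x, y) -> A (x', y') ->
  A (x - x', y - y').
Proof.
case: A_sa => -[_ Alin _] _ _ Ax Ax'; have := Alin (-1) _ _ Ax' Ax.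
by rewrite scaleN1r addrC.
Qed.

(** The part [n] of [h] orthogonal to the range satisfies [A n = z^* n], since [A] is its own
    adjoint; the lower bound at [z^*] then gives [n = 0]. The lower bound at [z] gives
    uniqueness. *)
Lemma self_adjoint_solve z h : 'Im z != 0 -> exists! x, A (x, h + z *: x).
Proof.
move=> z0; have [Alin _ AE] := A_sa; have Asym := self_adjoint_symmetric.
have [c c0 cE] : exists2 c : R, 0 < c & `|'Im z| = c%:C%C.
  by apply: gtc0_real_complex; rewrite normr_gt0.
have Acl : closed A by rewrite -AE; exact: closed_adjoint.
have Az x y : A (x, y) -> c%:C%C * `|x| <= `|y - z *: x|.
  by rewrite -cE; exact: symmetric_below.
have [x [y [n [Axy hE]]]] := range_decomposition h Alin Acl c0 Az.
rewrite AE => /(symmetric_below z^* Asym); rewrite subrr normr0 Im_conj normrN.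
rewrite pmulr_rle0 ?normr_gt0 // normr_le0 => /eqP n0.
exists x; split; first by rewrite hE n0 addr0 subrK.
move=> x' Ax'; apply/eqP; rewrite -subr_eq0 -normr_le0.
have Ax : A (x, h + z *: x) by rewrite hE n0 addr0 subrK.
have := symmetric_below z Asym (self_adjoint_subr Ax Ax').
rewrite opprD addrACA subrr add0r -scalerBr subrr normr0.
by rewrite pmulr_rle0 ?normr_gt0.
Qed.

Lemma resolventP z h : 'Im z != 0 ->
  A (resolvent A z h, h + z *: resolvent A z h).
Proof.
move=> /(self_adjoint_solve h)[x [Ax _]].
exact: (xgetPex 0 (ex_intro (fun x => A (x, h + z *: x)) x Ax)).
Qed.

Lemma resolvent_le z h : 'Im z != 0 -> `|'Im z| * `|resolvent A z h| <= `|h|.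
Proof.
move=> /(resolventP h)/(symmetric_below z self_adjoint_symmetric).
by rewrite addrK.
Qed.

Lemma resolvent_eq z h x : 'Im z != 0 -> A (x, h + z *: x) ->
  resolvent A z h = x.
Proof.
move=> z0 Ax; have [x' [_ uniq]] := self_adjoint_solve h z0.
by rewrite -(uniq _ Ax) -(uniq _ (resolventP h z0)).
Qed.

Lemma resolventB z h k : 'Im z != 0 ->
  resolvent A z (h - k) = resolvent A z h - resolvent A z k.
Proof.
move=> z0; apply: resolvent_eq => //.
rewrite scalerBr addrACA -opprD.
exact: self_adjoint_subr (resolventP h z0) (resolventP k z0).
Qed.

Lemma resolventZ z c h : 'Im z != 0 ->
  resolvent A z (c *: h) = c *: resolvent A z h.
Proof.
move=> z0; apply: resolvent_eq => //; rewrite scalerA mulrC -scalerA -scalerDr.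
have [[A0 Alin _] _ _] := A_sa; have := Alin c _ _ (resolventP h z0) A0.
by rewrite -[(0, 0)]/(0 : H * H) addr0.
Qed.

Lemma resolvent_identity w z h : 'Im w != 0 -> 'Im z != 0 ->
  resolvent A w h - resolvent A z h =
  (w - z) *: resolvent A z (resolvent A w h).
Proof.
move=> w0 z0; rewrite -resolventZ //.
(* The resolvent at [w] solves the equation at [z] with right-hand side shifted by [w - z] times
   itself. *)
rewrite -{1}(@resolvent_eq z (h + (w - z) *: resolvent A w h) (resolvent A w
  h)) //.
  by rewrite -resolventB // addrC addKr.
by rewrite -addrA -scalerDl subrK; exact: resolventP.
Qed.

(** By the resolvent identity the difference quotient is the resolvent at [z] applied to the one at
    [z + h]. Its limit is the squared resolvent, and a second use of the identity makes the error of
    order [h]. *)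
Lemma derivable_resolvent_inner g k z : 'Im z != 0 ->
  derivable ((fun w => inner (resolvent A w g) k) : R[i]^o -> R[i]^o) z 1.
Proof.
move=> z0; have m0 : 0 < `|'Im z| by rewrite normr_gt0.
set m := `|'Im z| in m0.
apply/cvg_ex; exists (inner (resolvent A z (resolvent A z g)) k).
apply/cvgrPdist_le => e e0.
have M0 : 0 < `|g| * `|k| + 1 by rewrite ltr_wpDl // mulr_ge0.
(* The error contains three resolvents: two at [z], of norm at most [1 / m], and one at [z + h], of
   norm at most [2 / m] once [|h| < m / 2]. *)
have E0 : 0 < m / 2 * (m * (m * e)) by rewrite !mulr_gt0 // invr_gt0.
near=> h.
have h0 : h != 0 by near: h; exact: nbhs_dnbhs_neq.
have hm : `|h| < m / 2 by near: h; apply: dnbhs0_lt; rewrite divr_gt0.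
have hw : m / 2 <= `|'Im (h + z)|.
  rewrite raddfD /= addrC; apply: le_trans (lerB_normD _ _).
  rewrite -/m {2}[m]splitr -addrA lerDl subr_ge0.
  by rewrite (le_trans (normr_Im_le _)) // ltW.
have w0 : 'Im (h + z) != 0.
  by rewrite -normr_gt0 (lt_le_trans _ hw) // divr_gt0.
rewrite /= [h *: 1]mulr1 -innerBl resolvent_identity // addrK innerZl.
rewrite /GRing.scale /= mulKf //.
rewrite -innerBl -resolventB // (le_trans (inner_cauchy_schwarz _ _)) //.
rewrite -(ler_pM2l m0) mulrA.
set u := resolvent A (h + z) g; set v := resolvent A z g.
apply: (@le_trans _ _ (`|v - u| * `|k|)); first by rewrite ler_wpM2r
  ?resolvent_le.
rewrite -normrN opprB resolvent_identity // addrK normrZ -/u.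
have um : m / 2 * `|u| <= `|g|.
  by rewrite (le_trans _ (resolvent_le g w0)) // ler_wpM2r.
have ru : m * `|resolvent A z u| <= `|u| by exact: resolvent_le.
rewrite -(ler_pM2l m0) -(ler_pM2l (x := m / 2)) ?divr_gt0 //.
apply: (@le_trans _ _ (`|h| * (`|g| * `|k|))).
  have -> : m / 2 * (m * (`|h| * `|resolvent A z u| * `|k|)) =
      `|h| * (m / 2 * (m * `|resolvent A z u|) * `|k|) by ring.
  rewrite ler_wpM2l // ler_wpM2r // (le_trans _ um) // ler_wpM2l // ltW //.
  by rewrite divr_gt0.
have hE : `|h| < m / 2 * (m * (m * e)) / (`|g| * `|k| + 1).
  by near: h; apply: dnbhs0_lt; rewrite divr_gt0.
rewrite (le_trans (ler_wpM2r _ (ltW hE))) ?mulr_ge0 //.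
by rewrite mulrAC ler_pdivrMr // ler_pM2l // lerDl.
Unshelve. all: by end_near. Qed.

(** [A] maps the resolvent vector to [g] plus [z] times it. In this closed form the value at [i] is
    visibly [i], and differentiability reduces to that of the resolvent. *)
Lemma weyl_titchmarshE g z : 'Im z != 0 -> `|g| = 1 ->
  weyl_titchmarsh A g z = z + (z ^+ 2 + 1) * inner (resolvent A z g) g.
Proof.
move=> z0 g1; have Ag := resolventP g z0.
rewrite /weyl_titchmarsh.
have -> : opval A (resolvent A z g) = g + z *: resolvent A z g.
  have [[_ _ Afun] _ _] := A_sa; apply: (Afun _ _ _ _ Ag).
  exact: (xgetPex 0 (ex_intro (fun y => A (_, y)) _ Ag)).
rewrite innerDl innerZl innerDl innerZl inner_normE g1.
by ring.
Qed.

Lemma derivable_weyl (c : R[i]) g z : 'Im z != 0 ->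
  derivable ((fun w => c * (w + (w ^+ 2 + 1) * inner (resolvent A w g) g))
    : R[i]^o -> R[i]^o) z 1.
Proof.
move=> z0.
have dF := @derivable_resolvent_inner g g z z0.
set F : R[i]^o -> R[i]^o := fun w => inner _ _ in dF.
pose I : R[i]^o -> R[i]^o := id.
have dI : derivable I z 1 by exact: derivable_id.
have dc (b : R[i]) : derivable (cst b : R[i]^o -> R[i]^o) z 1 by
  exact: derivable_cst.
have := derivableM (dc c) (derivableD dI (derivableM (derivableD (derivableM
  dI dI) (dc 1)) dF)).
exact.
Qed.

End SelfAdjoint.

(** * Boundary coordinates on [H_+] *)

(* Locked, since rewriting with distributivity would unfold [plus_form]. *)
HB.lock Definition defect_coef (R : realType) (H : hilbertType R)
  (Adot : csym_operator H) (e f : Hplus Adot) : R[i] := plus_form f e.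

Section Extensions.
Variables (R : realType) (H : hilbertType R) (Adot : csym_operator H).
Hypothesis Adot_defi : deficiency_indices Adot 1 1.
Variables gp gm : Hplus Adot.
Hypotheses (gp_defect : defect_space Adot 'i gp)
  (gm_defect : defect_space Adot (- 'i) gm).
Hypotheses (gp_norm : `|gp| = 1) (gm_norm : `|gm| = 1).
Implicit Types (e f k : Hplus Adot) (u : Hminus Adot) (x y h : H).

Local Notation AD := (csym_graph Adot).
Local Notation al := (defect_coef gp).
Local Notation be := (defect_coef gm).

Lemma hplus_exists x y : adjoint Adot (x, y) ->
  exists f, (f : H) = x /\ astar f = y.
Proof.
move=> Axy; have xP : x \in hplus_pred Adot by apply/asboolP; exists y.
by exists (HPlus xP); split=> //; exact: astarE.
Qed.

Lemma hplusE (c : R[i]) f k :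
  hplus_val (c *: f + k) = c *: hplus_val f + hplus_val k.
Proof. by []. Qed.

Lemma hplusBE f k : hplus_val (f - k) = hplus_val f - hplus_val k.
Proof. by []. Qed.

Lemma astarB f k : astar (f - k) = astar f - astar k.
Proof. by rewrite addrC -scaleN1r astar_linear scaleN1r addrC. Qed.

Lemma astarZ (c : R[i]) f : astar (c *: f) = c *: astar f.
Proof. by have := astar_linear c f (f - f); rewrite astarB !subrr !addr0. Qed.

Lemma astar_gp : astar gp = 'i *: (gp : H).
Proof. exact: astarE. Qed.

Lemma astar_gm : astar gm = - 'i *: (gm : H).
Proof. exact: astarE. Qed.

Lemma plus_formE f k :
  plus_form f k = inner (f : H) (k : H) + inner (astar f) (astar k).
Proof. by []. Qed.

Lemma defect_coefE e f : defect_coef e f = plus_form f e.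
Proof. by rewrite defect_coef.unlock. Qed.

Lemma defect_coef_linear e (c : R[i]) f k :
  defect_coef e (c *: f + k) = c * defect_coef e f + defect_coef e k.
Proof. by rewrite !defect_coefE linearDl linearZl_LR. Qed.

Lemma defect_coefD e f k :
  defect_coef e (f + k) = defect_coef e f + defect_coef e k.
Proof. by rewrite -{1}[f]scale1r defect_coef_linear mul1r. Qed.

Lemma defect_coefZ e c f : defect_coef e (c *: f) = c * defect_coef e f.
Proof. by rewrite !defect_coefE linearZl_LR. Qed.

Lemma defect_coefB e f k :
  defect_coef e (f - k) = defect_coef e f - defect_coef e k.
Proof. by rewrite -scaleN1r defect_coefD defect_coefZ mulN1r. Qed.

Lemma defect_coef0 e : defect_coef e 0 = 0.
Proof. by rewrite -(subrr 0) defect_coefB subrr. Qed.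

Lemma defect_coef_gpE f :
  al f = inner (f : H) (gp : H) - 'i * inner (astar f) (gp : H).
Proof. by rewrite defect_coefE plus_formE astar_gp innerZr conjCi mulNr. Qed.

Lemma defect_coef_gmE f :
  be f = inner (f : H) (gm : H) + 'i * inner (astar f) (gm : H).
Proof.
by rewrite defect_coefE plus_formE astar_gm innerZr rmorphN /= conjCi opprK.
Qed.

Lemma defect_coef_gp_gp : al gp = 1.
Proof. by rewrite defect_coefE -dot_norm_sqr -plus_normE gp_norm expr1n. Qed.

Lemma defect_coef_gm_gm : be gm = 1.
Proof. by rewrite defect_coefE -dot_norm_sqr -plus_normE gm_norm expr1n. Qed.

Lemma defect_coef_gm_gp : be gp = 0.
Proof.
by rewrite defect_coef_gmE astar_gp innerZl mulrA -expr2 sqrCi mulN1r subrr.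
Qed.

Lemma defect_coef_gp_gm : al gm = 0.
Proof.
by rewrite defect_coefE plus_form_herm -defect_coefE defect_coef_gm_gp conjC0
  mulr0.
Qed.

Lemma csym_adjoint x y : AD (x, y) -> adjoint Adot (x, y).
Proof. exact: csym_sym. Qed.

(** Moving [Adot] onto [gp] makes the two terms of the [(+)]-product cancel. *)
Lemma defect_coef_gp_dom f : AD (f : H, astar f) -> al f = 0.
Proof.
move=> Af; have /= E := gp_defect Af.
by rewrite defect_coef_gpE E innerZr conjCi mulrA mulrN -expr2 sqrCi opprK
  mul1r subrr.
Qed.

Lemma defect_coef_gm_dom f : AD (f : H, astar f) -> be f = 0.
Proof.
move=> Af; have /= E := gm_defect Af.
rewrite defect_coef_gmE E innerZr rmorphN /= conjCi opprK mulrA -expr2 sqrCi.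
by rewrite mulN1r subrr.
Qed.

Lemma dim1_colinear (S : set H) x y : has_dim S 1 -> S x -> S y -> x != 0 ->
  exists c, y = c *: x.
Proof.
move=> [e [Se _]] /Se[c xE] /Se[d yE]; rewrite !big_ord1 in xE yE.
move=> x0; exists (d ord0 / c ord0); rewrite xE yE scalerA divfK //.
by apply: contra_neq x0 => c0; rewrite xE c0 scale0r.
Qed.

Lemma hplus_neq0 f : `|f| = 1 -> (f : H) != 0.
Proof.
move=> f1; apply/eqP => f0; have : f = 0 by exact: val_inj.
by move=> E; move: f1; rewrite E normr0 => /eqP; rewrite eq_sym oner_eq0.
Qed.

Lemma defect_gp x : adjoint Adot (x, 'i *: x) -> exists c, x = c *: (gp : H).
Proof.
move=> Ax; apply: (dim1_colinear Adot_defi.1) => //.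
exact: hplus_neq0.
Qed.

Lemma defect_gm x : adjoint Adot (x, - 'i *: x) -> exists c, x = c *: (gm : H).
Proof.
move=> Ax; apply: (dim1_colinear Adot_defi.2) => //.
exact: hplus_neq0.
Qed.

Lemma inner_gp_neq0 : inner (gp : H) (gp : H) != 0.
Proof. by rewrite (dnorm_eq0 inner) hplus_neq0. Qed.

(** The orthogonal complement of the range of [Adot + i] is spanned by [gp]. The condition on [al]
    puts [(A^* + i) f] in that range, so [f] differs from a vector of [Dom(Adot)] by a multiple of
    [gm]; the condition on [be] makes this multiple zero. *)
Lemma dom_defect_coef0 f : al f = 0 -> be f = 0 -> AD (f : H, astar f).
Proof.
move=> alf bef.
have Abelow x y : AD (x, y) -> (1 : R)%:C%C * `|x| <= `|y - - 'i *: x|.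
  move=> Axy; have := symmetric_below (- 'i) (@csym_sym _ _ Adot) Axy.
  by rewrite raddfN /= Im_i normrN normr1.
have [x [y [n [Axy hE]]]] := range_decomposition (astar f + 'i *: (f : H))
  (@csym_linear _ _ Adot) (@csym_closed _ _ Adot) ltr01 Abelow.
rewrite rmorphN /= conjCi opprK => /defect_gp[c nE].
have [f0 [xE yE]] := hplus_exists (csym_adjoint Axy).
have Af0 : AD (f0 : H, astar f0) by rewrite xE yE.
have inner_al k : inner (astar k + 'i *: (k : H)) (gp : H) = 'i * al k.
  by rewrite innerDl innerZl defect_coef_gpE mulrBr mulrA -expr2 sqrCi mulN1r
    opprK addrC.
have c0 : c = 0.
  apply/eqP; rewrite -(mulIr_eq0 _ (mulIf inner_gp_neq0)) -innerZl -nE.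
  have := inner_al f; rewrite hE innerDl scaleNr opprK -xE -yE inner_al.
  by rewrite alf (defect_coef_gp_dom Af0) mulr0 add0r => ->.
have : adjoint Adot (hplus_val (f - f0), - 'i *: hplus_val (f - f0)).
  have -> : - 'i *: hplus_val (f - f0) = astar (f - f0); last exact: astarP.
  have := hE; rewrite nE c0 scale0r addr0 -xE -yE => hE'.
  rewrite astarB hplusBE scalerBr !scaleNr opprK.
  rewrite -[astar f](addrK ('i *: (f : H))) hE' scaleNr opprK [RHS]addrC.
  by rewrite -!addrA addKr addrC.
move=> /defect_gm[d dE].
have fE : f = f0 + d *: gm by apply/eqP; rewrite addrC -subr_eq;
  apply/eqP/val_inj.
have d0 : d = 0.
  move: bef; rewrite fE defect_coefD defect_coefZ defect_coef_gm_gm mulr1.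
  by rewrite (defect_coef_gm_dom Af0) add0r.
by rewrite fE d0 scale0r addr0.
Qed.

(** Von Neumann's decomposition of [H_+] into [Dom(Adot)] and the two deficiency lines. *)
Lemma dom_component f :
  let f0 := f - (al f *: gp + be f *: gm) in AD (f0 : H, astar f0).
Proof.
apply: dom_defect_coef0; rewrite defect_coefB defect_coefD !defect_coefZ.
  by rewrite defect_coef_gp_gp defect_coef_gp_gm mulr0 mulr1 addr0 subrr.
by rewrite defect_coef_gm_gm defect_coef_gm_gp mulr0 mulr1 add0r subrr.
Qed.

(** Only [f] needs decomposing: its part in [Dom(Adot)] contributes nothing, and pairing [gp] and
    [gm] with [k] and [A^* k] reproduces the coordinates of [k]. *)
Lemma green_identity f k : inner (astar f) (k : H) - inner (f : H) (astar k) =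
  'i * (al f * (al k)^* - be f * (be k)^*).
Proof.
have [f0 fE A0] : exists2 f0, f = al f *: gp + (be f *: gm + f0) &
    AD (f0 : H, astar f0).
  exists (f - (al f *: gp + be f *: gm)); last exact: dom_component.
  by rewrite addrA addrC subrK.
have f0k : inner (astar f0) (k : H) = inner (f0 : H) (astar k).
  by have := astarP k; exact.
rewrite {1 2}fE !astar_linear !hplusE !innerDl !innerZl f0k astar_gp astar_gm.
rewrite !innerZl [al k]defect_coef_gpE [be k]defect_coef_gmE rmorphB rmorphD /=.
rewrite !rmorphM /= conjCi -!dot_hermC.
have ii : 'i * 'i = -1 :> R[i] by rewrite -expr2 sqrCi.
by ring: ii.
Qed.

Lemma hminus_defect u : (forall k, AD (k : H, astar k) -> u k = 0) ->
  forall f, u f = (al f)^* * u gp + (be f)^* * u gm.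
Proof.
move=> u0 f; have A0 := dom_component f.
rewrite -{1}[f](subrK (al f *: gp + be f *: gm)) addrC -addrA !hminusP.
by rewrite (u0 _ A0) addr0.
Qed.

(** Density of [Dom(Adot)]. As [phi] and [psi] vanish there, testing on that domain separates the
    part of an equation in [H] from its part along [phi] and [psi]. *)
Lemma embed_eq0 h : (forall k, AD (k : H, astar k) -> embed Adot h k = 0) ->
  h = 0.
Proof.
move=> h0; apply: (adjoint_functional (@csym_dense _ _ Adot) (x := 0)).
  move=> x y Axy; rewrite inner0r.
  have [k [kE yE]] := hplus_exists (csym_adjoint Axy).
  by have /= E := h0 k; rewrite dot_hermC -kE E ?conjC0 // kE yE.
exact: adjoint0.
Qed.

(** * Extensions cut out by a boundary condition *)

(* [A] for [p = q = 1], the main operator [T_1a] for [p = 1 - a] and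
   [q = 1 + a]. *)
Definition boundary_extension (p q : R[i]) : set (H * H) :=
  [set w | exists f, [/\ hplus_val f = w.1, astar f = w.2 & p * al f =
    q * be f]].

Local Notation ext := boundary_extension.

Lemma boundary_extension_linear p q : linear_operator (ext p q).
Proof.
split.
- exists 0; split=> //; last by rewrite !defect_coef0 !mulr0.
  by apply: astarE; exact: adjoint0.
- move=> c [x y] [x' y'] [f [/= <- <- fpq]] [k [/= <- <- kpq]].
  exists (c *: f + k); split=> //=; first exact: astar_linear.
  by rewrite !defect_coef_linear !mulrDr kpq mulrCA fpq mulrCA.
- move=> x y y' [f [/= fx <- _]] [k [/= kx <- _]].
  by congr astar; apply: val_inj; rewrite /= fx.
Qed.

Lemma sub_boundary_extension p q : AD `<=` ext p q.
Proof.
move=> [x y] Axy; have [f [fx fy]] := hplus_exists (csym_adjoint Axy).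
have Af : AD (f : H, astar f) by rewrite fx fy.
exists f; split=> //.
by rewrite defect_coef_gp_dom // defect_coef_gm_dom // !mulr0.
Qed.

Lemma boundary_extension_sub p q : ext p q `<=` adjoint Adot.
Proof. by move=> [x y] [f [/= <- <- _]]; exact: astarP. Qed.

(** As [q != 0], [al] determines [be] on the boundary condition, so the domain of the extension
    exceeds [Dom(Adot)] by one dimension only; a single vector of [T] outside [Adot] already fills
    it. *)
Lemma boundary_extension_max p q T : q != 0 -> linear_operator T ->
  AD `<=` T -> T `<=` ext p q -> ~ (T `<=` AD) -> T = ext p q.
Proof.
move=> q0 [T0 Tlin Tfun] AT Text nTA; apply/seteqP;
  split=> // -[x y] [k [/= <- <- kpq]].
have [[x' y'] nw] : exists w, ~ (T w -> AD w).
  by apply: contrapT => nex; apply: nTA => w Tw; apply: contrapT => nAw;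
    apply: nex; exists w => /(_ Tw).
have [T' nA'] : T (x', y') /\ ~ AD (x', y').
  split; first by apply: contrapT => nT; apply: nw => /nT.
  by move=> AA; exact: nw.
have [f [/= fx fy fpq]] := Text _ T'.
have alf0 : al f != 0.
  apply/eqP => alf0; apply: nA'; rewrite -fx -fy; apply: dom_defect_coef0 => //.
  by apply: (mulfI q0); rewrite -fpq alf0 !mulr0.
pose c := al k / al f; have k0 : AD (hplus_val (k - c *: f), astar (k - c *:
  f)).
  have alE : al (k - c *: f) = 0.
    by rewrite defect_coefB defect_coefZ divfK ?subrr.
  apply: dom_defect_coef0 => //; apply: (mulfI q0); rewrite mulr0.
  rewrite defect_coefB defect_coefZ mulrBr -kpq mulrCA -fpq mulrCA -mulrBr.
  by rewrite divfK // subrr mulr0.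
have := Tlin c _ _ T' (AT _ k0); rewrite -fx -fy.
have -> : c *: (hplus_val f, astar f) + (hplus_val (k - c *: f), astar (k - c
  *: f))
  = (hplus_val (c *: f + (k - c *: f)), astar (c *: f + (k - c *: f))).
  by rewrite astar_linear.
by rewrite addrC subrK.
Qed.

Lemma symmetric_boundary T f k : symmetric_operator T ->
  T (f : H, astar f) -> T (k : H, astar k) -> al f * (al k)^* = be f * (be k)^*.
Proof.
move=> Tsym Tf Tk; apply/eqP; rewrite -subr_eq0 -(mulrI_eq0 _ (mulfI (neq0Ci
  R[i]))).
by rewrite -green_identity; have /= -> := Tsym _ Tk _ _ Tf; rewrite subrr.
Qed.

(** Green's identity against [gp + gm], whose coordinates are [(1, 1)], forces [al = be] on
    [Dom(A)]; maximality gives equality. *)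
Lemma self_adjoint_boundary A : self_adjoint A -> AD `<=` A ->
  opdom A ((gp : H) + (gm : H)) -> A = ext 1 1.
Proof.
move=> A_sa AdA [y Ay]; have [Alin _ AE] := A_sa.
have AA : A `<=` adjoint Adot.
  by rewrite -AE => w Aw x' y' /AdA; exact: Aw.
have [s [sx sy]] := hplus_exists (AA _ Ay).
have sE : s = gp + gm by exact: val_inj.
have als : al s = 1 by rewrite sE defect_coefD defect_coef_gp_gp
  defect_coef_gp_gm addr0.
have bes : be s = 1 by rewrite sE defect_coefD defect_coef_gm_gm
  defect_coef_gm_gp add0r.
apply: boundary_extension_max => //.
  move=> [x y'] Axy; have [f [fx fy]] := hplus_exists (AA _ Axy).
  exists f; split=> //; rewrite !mul1r.
  have := @symmetric_boundary _ f s (self_adjoint_symmetric A_sa).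
  by rewrite als bes conjC1 !mulr1 fx fy sx sy; apply.
move=> /(_ _ Ay); rewrite -sx -sy => /defect_coef_gp_dom; rewrite als => /eqP.
by rewrite oner_eq0.
Qed.

(** * L-systems *)

Section Operators.
Variables phi psi : Hminus Adot.
Hypotheses (phiE : forall f, phi f = (al f)^*) (psiE : forall f, psi f =
  (be f)^*).

Implicit Types (B : bounded_op (Hplus Adot) (Hminus Adot)) (T : set (H * H)).

(* [B = A^* - i/2 (., p phi - q psi) (phi + psi)] for real [p] and [q]. *)
Definition boundary_form (p q : R[i]) (B : bounded_op (Hplus Adot) (Hminus
  Adot)) :=
  forall f k, B f k = inner (astar f) (k : H)
    - 'i / 2 * (p * al f - q * be f) * (al k + be k)^*.

(** Testing on [Dom(Adot)] removes the rank-one term and identifies [y]; testing on [gp], where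
    [al + be = 1], then shows that its coefficient vanishes. *)
Lemma boundary_form_embed p q B f y : boundary_form p q B ->
  B f = embed Adot y <-> astar f = y /\ p * al f = q * be f.
Proof.
move=> BE; split=> [By|[fy fpq]]; last first.
  apply/val_inj/funext => k /=; rewrite BE fpq subrr mulr0 mul0r subr0 fy.
  by [].
have yE k : inner (astar f) (k : H)
    - 'i / 2 * (p * al f - q * be f) * (al k + be k)^* = inner y (k : H).
  by rewrite -BE By.
have y0 : y - astar f = 0.
  apply: embed_eq0 => k Ak; rewrite /= innerBl -yE (defect_coef_gp_dom Ak).
  rewrite (defect_coef_gm_dom Ak) addr0 conjC0 mulr0 subr0.
  exact: subrr.
have yf : astar f = y by apply/esym/eqP; rewrite -subr_eq0 y0.
split=> //; apply/eqP; rewrite -subr_eq0.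
have := yE gp; rewrite yf defect_coef_gp_gp defect_coef_gm_gp addr0 conjC1
  mulr1.
rewrite -[RHS]subr0 => /addrI/oppr_inj/eqP; rewrite mulf_eq0.
by rewrite mulf_eq0 invr_eq0 (negPf (neq0Ci _)) pnatr_eq0.
Qed.

Lemma quasi_kernel_boundary p q B : boundary_form p q B ->
  quasi_kernel B = ext p q.
Proof.
move=> BE; apply/seteqP; split=> -[x y] [f] /=.
  by move=> [fx /(boundary_form_embed _ _ BE)[fy fpq]]; exists f.
by move=> [fx fy fpq]; exists f; split=> //; exact/(boundary_form_embed _ _ BE).
Qed.

Lemma bop_extendsE B T : bop_extends B T <-> T `<=` quasi_kernel B.
Proof.
split=> [BT [x y] /BT[f [fx fy]]|BT x y /BT[f [fx fy]]]; by exists f.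
Qed.

(** Moving [A^*] to the other argument costs the boundary term of Green's identity; [p + q = 2] is
    exactly what lets the rank-one term absorb it, with [p] and [q] exchanged. *)
Lemma boundary_form_adj p q B : p \is Num.real -> q \is Num.real ->
  p + q = 2 -> boundary_form p q B -> boundary_form q p (adj_op B).
Proof.
move=> /CrealP pC /CrealP qC pq BE f k /=; rewrite BE rmorphB /= !rmorphM /=.
rewrite conjCK fmorphV /= conjCi rmorphB /= !rmorphM /= pC qC -dot_hermC.
rewrite conjC_nat rmorphD /=.
have -> : inner (f : H) (astar k) =
    inner (astar f) (k : H) - 'i * (al f * (al k)^* - be f * (be k)^*).
  by rewrite -green_identity opprB addrC subrK.
have -> : q = 2 - p by rewrite -pq addrC addKr.
move: (inner _ _) (al f) (be f) (al k)^* (be k)^* => t b c d e.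
by field.
Qed.

Lemma boundary_form_re p q B : p \is Num.real -> q \is Num.real ->
  p + q = 2 -> boundary_form p q B -> boundary_form 1 1 (re_op B).
Proof.
move=> pR qR pq BE f k; have BE' := boundary_form_adj pR qR pq BE.
have -> : re_op B f k = 2^-1 * (B f k + adj_op B f k) by [].
rewrite BE BE'.
have -> : q = 2 - p by rewrite -pq addrC addKr.
move: (inner _ _) (al f) (be f) (al k + be k)^* => t b c d.
by field.
Qed.

(** The imaginary part has rank one along [phi + psi]. For [q - p = 2 a] the coefficient is [a / 2],
    whence the square root in [chi1a]. *)
Lemma boundary_form_im p q B : p \is Num.real -> q \is Num.real ->
  p + q = 2 -> boundary_form p q B ->
  forall f k, im_op B f k = (q - p) / 4 * (al f + be f) * (al k + be k)^*.
Proof.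
move=> pR qR pq BE f k; have BE' := boundary_form_adj pR qR pq BE.
have -> : im_op B f k = (2 * 'i)^-1 * (B f k - adj_op B f k) by [].
rewrite BE BE'.
have i0 := neq0Ci R[i].
move: (inner _ _) (al f) (be f) (al k + be k)^* => t b c d.
by field.
Qed.

Lemma re_op_adj B : adj_op (re_op B) = re_op B.
Proof.
apply/val_inj/funext => f; apply/val_inj/funext => k.
change ((2^-1 * (B k f + (B f k)^*))^* = 2^-1 * (B f k + (B k f)^*)).
by rewrite rmorphM rmorphD /= conjCK addrC fmorphV /= conjC_nat.
Qed.

Lemma boundary_form_state (p q : R) :
  boundary_form p%:C%C q%:C%C
    (star_op Adot - ('i / 2) *: rank1 (p%:C%C *: phi - q%:C%C *: psi) (phi +
      psi)).
Proof.
move=> f k; rewrite /= !fctE /GRing.scale /=.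
rewrite /pairing /= !fctE /GRing.scale /= !phiE !psiE.
rewrite rmorphB !rmorphM /= !conjCK rmorphD /= mulrA.
have rC (r : R) : (r%:C%C : R[i])^* = r%:C%C by apply/CrealP;
  rewrite complex_real.
by rewrite !rC.
Qed.

(** * Construction of the L-system *)

Variable a : R.
Hypothesis a_gt1 : 1 < a.
Local Notation p1 := ((1 - a)%:C%C : R[i]).
Local Notation q1 := ((1 + a)%:C%C : R[i]).

Definition state1a := star_op Adot
  - ('i / 2) *: rank1 ((1 - a)%:C%C *: phi - (1 + a)%:C%C *: psi) (phi + psi).

Definition chi1a : Hminus Adot := (Num.sqrt (a / 2))%:C%C *: (phi + psi).

Lemma p1_real : p1 \is Num.real. Proof. by rewrite complex_real. Qed.

Lemma q1_real : q1 \is Num.real. Proof. by rewrite complex_real. Qed.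

Lemma p1Dq1 : p1 + q1 = 2.
Proof.
rewrite -(rmorphD (real_complex R)) /= -(rmorph_nat (real_complex R)).
by congr (_%:C)%C; ring.
Qed.

Lemma q1_gt0 : 0 < q1.
Proof. by rewrite ltcR ltr_pwDl // ltW // (lt_trans ltr01). Qed.

Lemma q1_neq0 : q1 != 0.
Proof. by rewrite gt_eqF // q1_gt0. Qed.

Lemma norm_p1 : `|p1| = (a - 1)%:C%C.
Proof.
rewrite -normrN -(rmorphN (real_complex R)) opprB ger0_norm //.
by rewrite lecR subr_ge0 ltW.
Qed.

Lemma norm_p1_lt : `|p1| < q1.
Proof. by rewrite norm_p1 ltcR addrC ltrD2r (lt_trans _ ltr01) // oppr_lt0. Qed.

(** A multiple of [g_+ - kappa g_-]: it spans the domain of the main operator modulo [Dom(Adot)]. *)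
Definition defect1a : Hplus Adot := q1 *: gp + p1 *: gm.

Lemma al_defect1a : al defect1a = q1.
Proof.
rewrite defect_coef_linear defect_coefZ defect_coef_gp_gp defect_coef_gp_gm.
by rewrite mulr1 mulr0 addr0.
Qed.

Lemma be_defect1a : be defect1a = p1.
Proof.
rewrite defect_coef_linear defect_coefZ defect_coef_gm_gp defect_coef_gm_gm.
by rewrite mulr1 mulr0 add0r.
Qed.

(** This form shows that [T_1a + i] maps [defect1a] to a nonzero multiple of [gp], the direction
    missing from the range of [Adot + i]. *)
Lemma astar_defect1a :
  astar defect1a = - 'i *: (defect1a : H) + (2 * 'i * q1) *: (gp : H).
Proof.
rewrite astar_linear astarZ astar_gp astar_gm.
rewrite !hplusE scalerDr !scalerA addrAC -scalerDl.
by congr (_ *: _ + _ *: _); ring.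
Qed.

Lemma boundary_extension_defect1a : ext p1 q1 (defect1a : H, astar defect1a).
Proof. by exists defect1a; rewrite al_defect1a be_defect1a mulrC. Qed.

Lemma not_symmetric_sub T : ~ symmetric_operator T -> ~ (T `<=` AD).
Proof.
move=> nsym TA; apply: nsym => w Tw x y /TA Axy.
exact: (csym_sym (TA _ Tw)) Axy.
Qed.

Lemma ext1a_not_symmetric : ~ symmetric_operator (ext p1 q1).
Proof.
move=> sym; have := symmetric_boundary sym boundary_extension_defect1a
  boundary_extension_defect1a.
rewrite al_defect1a be_defect1a -!normCK => /eqP.
rewrite eqrXn2 // (gtr0_norm q1_gt0) => /eqP qp.
by have := norm_p1_lt; rewrite -qp ltxx.
Qed.

(** By Green's identity the imaginary part is [(|al f|^2 - |be f|^2) / 2], and the boundary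
    condition with [|1 - a| < 1 + a] gives [|be f| <= |al f|]. *)
Lemma ext1a_dissipative : dissipative (ext p1 q1).
Proof.
move=> x y [f [/= <- <- fpq]].
have := green_identity f f; rewrite [inner (f : H) _]dot_hermC.
rewrite ['Im _]ImE -!normCK => fE.
have -> : 'i * ((inner (astar f) (f : H))^* - inner (astar f) (f : H)) / 2 =
   (`|al f| ^+ 2 - `|be f| ^+ 2) / 2.
  by rewrite -opprB fE mulrN mulrA -expr2 sqrCi mulN1r opprK.
rewrite divr_ge0 // subr_ge0 ler_pXn2r ?nnegrE //.
rewrite -(ler_pM2l q1_gt0) -{1}(gtr0_norm q1_gt0) -normrM -fpq normrM.
by rewrite ler_wpM2r // ltW // norm_p1_lt.
Qed.

(** Dissipativity bounds [T_1a + i] below by [1], giving uniqueness and boundedness; [defect1a]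
    supplies the one dimension lacking for surjectivity. *)
Lemma ext1a_resolvent : resolvent_set (ext p1 q1) (- 'i).
Proof.
have [[T0 Tlin Tfun] Tdis] := (boundary_extension_linear p1 q1,
  ext1a_dissipative).
have below x y : ext p1 q1 (x, y) -> `|x| <= `|y - - 'i *: x|.
  move=> Txy; have := @coercive_below _ _ x y (- 'i).
  rewrite raddfN /= Im_i normrN normr1 mul1r; apply.
  by rewrite mulN1r oppr_le0; exact: Tdis.
have Abelow x y : AD (x, y) -> (1 : R)%:C%C * `|x| <= `|y - - 'i *: x|.
  by move=> /(@sub_boundary_extension p1 q1)/below; rewrite mul1r.
have sol h : exists x, ext p1 q1 (x, h + - 'i *: x).
  have [x [y [n [Axy hE]]]] := range_decomposition h
    (@csym_linear _ _ Adot) (@csym_closed _ _ Adot) ltr01 Abelow.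
  rewrite rmorphN /= conjCi opprK => /defect_gp[c nE].
  have [f0 [fx fy]] := hplus_exists (csym_adjoint Axy).
  pose d := c / (2 * 'i * q1); exists (hplus_val (d *: defect1a + f0)).
  have -> : h + - 'i *: hplus_val (d *: defect1a + f0) =
    astar (d *: defect1a + f0).
    rewrite astar_linear astar_defect1a hplusE hE nE fx fy.
    rewrite !scalerDr !scalerA [d * (2 * _ * _)]divfK; last first.
      by rewrite !mulf_neq0 ?neq0Ci ?q1_neq0 ?pnatr_eq0.
    by rewrite [d * - 'i]mulrC addrAC [_ + - 'i *: x]addrC subrKA -addrA addrC.
  have := Tlin d _ _ boundary_extension_defect1a (sub_boundary_extension p1 q1
    Axy).
  by rewrite astar_linear -fx -fy.
split.
  move=> h; have [x Tx] := sol h; exists x; split=> // x' Tx'.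
  have := Tlin (-1) _ _ Tx' Tx; rewrite scaleN1r => /below.
  rewrite /= opprD addrACA [- h + h]addrC subrr add0r scalerDr opprD scalerN.
  rewrite opprK addrACA subrr addNr addr0 normr0 normr_le0.
  by rewrite addrC subr_eq0 => /eqP.
exists 1 => h; rewrite mul1r.
have [x Tx] := sol h.
have /below := xgetPex 0 (ex_intro (fun x => ext p1 q1 (x, h + - 'i *: x)) x
  Tx).
by rewrite addrK.
Qed.

(** Testing against [defect1a] alone in Green's identity yields the boundary condition with the
    coefficients exchanged. *)
Lemma adjoint_ext1a : adjoint (ext p1 q1) `<=` ext q1 p1.
Proof.
move=> [x y] Txy.
have [|f [fx fy]] := @hplus_exists x y.
  by move=> x' y' /(@sub_boundary_extension p1 q1); exact: Txy.
exists f; split=> //; have /= := Txy _ _ boundary_extension_defect1a.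
rewrite -fx -fy => /eqP; rewrite -subr_eq0 green_identity mulf_eq0.
rewrite (negPf (neq0Ci _)) al_defect1a be_defect1a /= subr_eq0 => /eqP E.
apply: (can_inj (@conjCK _)); rewrite !rmorphM /=.
by rewrite (CrealP q1_real) (CrealP p1_real).
Qed.

Lemma boundary_form_state1a : boundary_form p1 q1 state1a.
Proof. exact: boundary_form_state. Qed.

Lemma boundary_form_re1a : boundary_form 1 1 (re_op state1a).
Proof.
exact: boundary_form_re p1_real q1_real p1Dq1 boundary_form_state1a.
Qed.

Lemma chi1aE k : chi1a k = (Num.sqrt (a / 2))%:C%C * (al k + be k)^*.
Proof. by rewrite /chi1a /= !fctE /GRing.scale /= phiE psiE rmorphD. Qed.

Lemma sqr_sqrt_a : (Num.sqrt (a / 2))%:C%C ^+ 2 = a%:C%C / 2 :> R[i].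
Proof.
rewrite -(rmorphXn (real_complex R)) /= sqr_sqrtr.
  by rewrite rmorphM fmorphV /= (rmorph_nat (real_complex R)).
by rewrite divr_ge0 // ltW // (lt_trans ltr01).
Qed.

Lemma sqrt_a_conj : (Num.sqrt (a / 2))%:C%C^* = (Num.sqrt (a / 2))%:C%C :> R[i].
Proof. by apply/CrealP; rewrite complex_real. Qed.

Lemma im_state1a f : im_op state1a f =
  channel_of chi1a (channel_adj (channel_of chi1a) f).
Proof.
apply/val_inj/funext => k.
apply: etrans.
  exact: (boundary_form_im p1_real q1_real p1Dq1 boundary_form_state1a).
apply: (@etrans _ _ ((1 * chi1a f)^* * chi1a k)); last by [].
rewrite mul1r !chi1aE rmorphM /= conjCK sqrt_a_conj.
rewrite mulrACA -expr2 sqr_sqrt_a mulrA; congr (_ * _ * _).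
rewrite -(rmorphB (real_complex R)) /=.
have -> : 1 + a - (1 - a) = a * 2 by ring.
rewrite (rmorphM (real_complex R)) /= (rmorph_nat (real_complex R)).
by field.
Qed.

Variable A : set (H * H).
Hypotheses (A_sa : self_adjoint A) (A_ext : AD `<=` A)
  (A_dom : opdom A ((gp : H) + (gm : H))).

Let A_E : A = ext 1 1 := self_adjoint_boundary A_sa A_ext A_dom.

(** [T] lies in the quasi-kernel of [state1a], and being non-symmetric it is not contained in
    [Adot]; maximality determines it. *)
Lemma main_op_state1a T : quasi_self_adjoint_extension Adot T ->
  bop_extends state1a T -> T = ext p1 q1.
Proof.
move=> [Tlin AT _ nsym] /bop_extendsE.
rewrite (quasi_kernel_boundary boundary_form_state1a) => TE.
apply: boundary_extension_max => //; first exact: q1_neq0.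
exact: not_symmetric_sub.
Qed.

Lemma quasi_self_adjoint_ext1a : quasi_self_adjoint_extension Adot (ext p1 q1).
Proof.
split; [exact: boundary_extension_linear|exact: sub_boundary_extension|
  exact: boundary_extension_sub|exact: ext1a_not_symmetric].
Qed.

Lemma star_extension_state1a : star_extension (ext p1 q1) state1a.
Proof.
have adjE := boundary_form_adj p1_real q1_real p1Dq1 boundary_form_state1a.
split.
- split; first exact: quasi_self_adjoint_ext1a.
  by exists (- 'i); exact: ext1a_resolvent.
- split; last exact: sub_boundary_extension.
  by apply/bop_extendsE; rewrite (quasi_kernel_boundary boundary_form_state1a).
- split.
    by apply/bop_extendsE; rewrite (quasi_kernel_boundary adjE);
      exact: adjoint_ext1a.
  move=> [x y] Axy x' y' /boundary_extension_sub/(_ _ _ Axy) /= E.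
  by rewrite dot_hermC -E -dot_hermC.
- rewrite /t_self_adjoint_biextension /self_adjoint_biextension.
  have reE := quasi_kernel_boundary boundary_form_re1a.
  split; last by rewrite reE -A_E.
  by split; [apply/bop_extendsE; rewrite reE;
    exact: sub_boundary_extension|exact: re_op_adj].
Qed.

Definition lsystem1a : lsystem Adot :=
  LSystem Adot_defi quasi_self_adjoint_ext1a ext1a_dissipative
    (ex_intro _ _ ext1a_resolvent) star_extension_state1a im_state1a.

(** * The impedance function of the system *)

Lemma inner_gp_gp : inner (gp : H) (gp : H) = 2^-1.
Proof.
have := defect_coef_gpE gp; rewrite defect_coef_gp_gp astar_gp innerZl mulrA.
rewrite -expr2 sqrCi mulN1r opprK => E.
have n2 : (2 : R[i]) != 0 by rewrite pnatr_eq0.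
by apply: (mulfI n2); rewrite mulfV // mulr2n mulrDl mul1r.
Qed.

(** Again [Dom(Adot)] isolates the equation in [H], and [gp] the coefficient of [phi + psi]. *)
Lemma state1a_equation z f :
  re_op state1a f - z *: embed Adot f = channel_of chi1a 1 <->
  astar f = z *: (f : H) /\ al f - be f = 2 * 'i * (Num.sqrt (a / 2))%:C%C.
Proof.
have n2 : (2 : R[i]) != 0 by rewrite pnatr_eq0.
set s : R[i] := (Num.sqrt (a / 2))%:C%C.
have lhsE k : (re_op state1a f - z *: embed Adot f) k =
    inner (astar f) (k : H) - 'i / 2 * (al f - be f) * (al k + be k)^*
      - z * inner (f : H) (k : H).
  change (re_op state1a f k - z * inner (f : H) (k : H) =
    inner (astar f) (k : H) - 'i / 2 * (al f - be f) * (al k + be k)^*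
      - z * inner (f : H) (k : H)).
  by rewrite boundary_form_re1a !mul1r.
have rhsE k : channel_of chi1a 1 k = s * (al k + be k)^*.
  change (1 * chi1a k = s * (al k + be k)^*); by rewrite mul1r chi1aE.
split=> [fE|[fz fs]]; last first.
  apply/val_inj/funext => k; apply: (etrans (lhsE k)).
  apply: (etrans _ (esym (rhsE k))); rewrite fs fz innerZl.
  move: (inner _ _) (_^*) => u c.
  have ii : 'i * 'i = -1 :> R[i] by rewrite -expr2 sqrCi.
  by field: ii.
have E k : inner (astar f) (k : H) - 'i / 2 * (al f - be f) * (al k + be k)^*
      - z * inner (f : H) (k : H) = s * (al k + be k)^*.
  by rewrite -lhsE -rhsE fE.
have /eqP : astar f - z *: (f : H) = 0.
  apply: embed_eq0 => k Ak; rewrite /= innerBl innerZl.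
  have := E k; rewrite (defect_coef_gp_dom Ak) (defect_coef_gm_dom Ak) addr0
    conjC0.
  by rewrite !mulr0 subr0.
rewrite subr_eq0 => /eqP fz; split=> //.
have := E gp; rewrite fz innerZl defect_coef_gp_gp defect_coef_gm_gp addr0
  conjC1.
rewrite !mulr1 => <-; move: (inner _ _) (al f - be f) => u c.
have ii : 'i * 'i = -1 :> R[i] by rewrite -expr2 sqrCi.
by field: ii.
Qed.

Variable g : H.
Hypotheses (g_defect : defect_space Adot 'i g) (g_norm : `|g| = 1).

Lemma impedance_vector z : 'Im z != 0 ->
  exists f, [/\ astar f = z *: (f : H),
    al f - be f = 2 * 'i * (Num.sqrt (a / 2))%:C%C &
    (Num.sqrt (a / 2))%:C%C * (al f + be f) = a%:C%C * weyl_titchmarsh A g z].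
Proof.
move=> z0; set s : R[i] := (Num.sqrt (a / 2))%:C%C.
have n2 : (2 : R[i]) != 0 by rewrite pnatr_eq0.
have [d gE] := defect_gp g_defect.
have dd : d * d^* = 2.
  apply: (mulIf (invr_neq0 n2)); rewrite mulfV // -inner_gp_gp -mulrA.
  by rewrite -innerZr -innerZl -gE inner_normE g_norm expr1n.
have d0 : d != 0.
  by apply: contra_eq_neq dd => ->; rewrite mul0r eq_sym.
have dC : d^* = 2 / d by rewrite -dd mulrAC mulfV // mul1r.
have := resolventP A_sa g z0; rewrite {1}A_E => -[x [/= xE xA]].
rewrite !mul1r => xb.
have xc := defect_coef_gpE x; rewrite xA innerDl innerZl xE -xE in xc.
rewrite {1}gE innerZl inner_gp_gp in xc.
(* With [g = d gp], the vector [g + (z - i) x] lies in [Ker(A^* - z)]. As [x] is in [Dom(A)], its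
   coordinates agree, so [al - be] of that vector is [d]; [t] scales it to the prescribed value. *)
have [t tE] : exists t, t = 2 * 'i * s / d by exists (2 * 'i * s / d).
exists (t *: (d *: gp + (z - 'i) *: x)).
have alE : al (t *: (d *: gp + (z - 'i) *: x)) = t * (d + (z - 'i) * al x).
  by rewrite defect_coefZ defect_coef_linear defect_coefZ defect_coef_gp_gp
    mulr1.
have beE : be (t *: (d *: gp + (z - 'i) *: x)) = t * ((z - 'i) * al x).
  by rewrite defect_coefZ defect_coef_linear defect_coefZ defect_coef_gm_gp
    mulr0 add0r -xb.
split.
- rewrite astarZ astar_linear astarZ xA astar_gp -xE.
  change (t *: (d *: ('i *: (gp : H)) + (z - 'i) *: (g + z *: (x : H))) =
    z *: (t *: (d *: (gp : H) + (z - 'i) *: (x : H)))).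
  rewrite [RHS]scalerA [z * t]mulrC -scalerA; congr (_ *: _).
  rewrite scalerA [d * 'i]mulrC -scalerA -gE !scalerDr addrA -scalerDl.
  by rewrite ['i + _]addrC subrK !scalerA [_ * z]mulrC.
- by rewrite alE beE tE; field.
rewrite alE beE (weyl_titchmarshE A_sa z0 g_norm) -xE gE innerZr dC xc tE.
have ii : 'i * 'i = -1 :> R[i] by rewrite -expr2 sqrCi.
have ss : s * s = a%:C%C / 2 by rewrite -expr2 sqr_sqrt_a.
have -> : a%:C%C = 2 * (s * s) by rewrite ss; field.
move: (inner _ _) => u.

by field: ii.
Qed.

Lemma is_impedance1a :
  is_impedance lsystem1a
    (fun z => a%:C%C * (z + (z ^+ 2 + 1) * inner (resolvent A z g) g)).
Proof.
move=> z z0; split; last first.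
  exact: (derivable_weyl A_sa).
have [f [fz fs fV]] := impedance_vector z0.
exists f; split.
  split; first exact/state1a_equation.
  move=> f' /state1a_equation[fz' fs'].
  (* Two solutions differ by a vector with [al = be], an eigenvector of [A] at a nonreal point,
     hence zero. *)
  have Ad : A (hplus_val (f - f'), z *: hplus_val (f - f')).
    rewrite A_E; exists (f - f'); split=> //.
      by rewrite astarB hplusBE scalerBr fz fz'.
    rewrite !mul1r !defect_coefB; apply/eqP.
    by rewrite -subr_eq0 opprD opprK addrACA [- al f' + _]addrC -[be f' -
      _]opprB fs' fs subrr.
  apply/eqP; rewrite -subr_eq0; apply/eqP/val_inj => /=.
  have := symmetric_below z (self_adjoint_symmetric A_sa) Ad.
  by rewrite subrr normr0 pmulr_rle0 ?normr_gt0 // normr_le0 => /eqP.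
rewrite -(weyl_titchmarshE A_sa z0 g_norm) -fV.
change ((Num.sqrt (a / 2))%:C%C * (al f + be f) = (1 * chi1a f)^*).
by rewrite mul1r chi1aE rmorphM /= conjCK sqrt_a_conj.
Qed.

(** * Uniqueness of the state-space operator *)

Lemma boundary_form_inj p q B B' : boundary_form p q B ->
  boundary_form p q B' -> B = B'.
Proof.
move=> BE BE'; apply/val_inj/funext => f; apply/val_inj/funext => k.
exact: etrans (BE f k) (esym (BE' f k)).
Qed.

Lemma bop_extends_dom B T f : bop_extends B T -> AD `<=` T ->
  AD (f : H, astar f) -> B f = embed Adot (astar f).
Proof.
by move=> BT AT /AT/BT[k [/= kf <-]]; congr (B _); apply: val_inj.
Qed.

(** The difference [E] of [S] and [A^*] vanishes on [Dom(Adot)] in its first argument, and in its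
    second by self-adjointness, so it is a matrix in the two coordinates. It kills [gp + gm], which
    leaves one row; the symmetry of [S] relates the entries. *)
Lemma biextension_form S : self_adjoint_biextension S ->
  quasi_kernel S = A -> exists c, c - c^* = - 'i /\
    forall f k, S f k = inner (astar f) (k : H) +
      (al f - be f) * (c * (al k)^* - c^* * (be k)^*).
Proof.
move=> [SAD SA] Sqk.
have S_dom f : AD (f : H, astar f) -> S f = embed Adot (astar f).
  exact: bop_extends_dom SAD _.
have SC f k : S f k = (S k f)^*.
  by rewrite -{1}SA.
have [E EE] : exists E : Hplus Adot -> Hminus Adot,
    forall f, E f = S f - embed Adot (astar f) by eexists.
have EK f k : E f k = S f k - inner (astar f) (k : H) by rewrite EE.
have EC f k : S f k = inner (astar f) (k : H) + E f k.
  by rewrite EK addrC subrK.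
have E_dom f : AD (f : H, astar f) -> E f = 0.
  by move=> Af; rewrite EE S_dom // subrr.
have E_lin c f k l : E (c *: f + k) l = c * E f l + E k l.
  have SL : S (c *: f + k) l = c * S f l + S k l by rewrite linearP.
  rewrite !EK SL astar_linear innerDl innerZl.
  move: (S f l) (S k l) (inner _ _) (inner _ _) => u v w t.
  by rewrite mulrBr opprD addrACA.
have E_van f k : AD (k : H, astar k) -> E f k = 0.
  move=> Ak; have /= AK := astarP f Ak.
  rewrite EK SC S_dom //= [inner (astar f) _]dot_hermC -AK.
  exact: subrr.
have EgpE k : E gp k = (al k)^* * E gp gp + (be k)^* * E gp gm.
  by apply: hminus_defect => l; exact: E_van.
have Egpgm : S (gp + gm) = embed Adot (astar (gp + gm)).
  have [y Ay] := A_dom; move: (Ay); rewrite -Sqk => -[f [/= fE Sf]].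
  have fs : f = gp + gm by exact: val_inj.
  move: Ay; rewrite A_E => -[f' [/= fE' fy _]].
  have -> : gp + gm = f' by apply: val_inj; exact: esym fE'.
  have ff' : f' = f by apply: val_inj; exact: etrans fE' (esym fE).
  by rewrite fy -Sf ff'.
have Egm k : E gm k = - E gp k.
  have := EE (gp + gm); rewrite Egpgm subrr => E0.
  have := E_lin 1 gp gm k; rewrite scale1r mul1r E0 => /esym/eqP.
  by rewrite addrC addr_eq0 => /eqP.
have ES f k : E f k = (al f - be f) * E gp k.
  have A0 := dom_component f.
  rewrite -{1}[f](subrK (al f *: gp + be f *: gm)) addrC -addrA !E_lin.
  rewrite (E_dom _ A0) Egm /= addr0.
  by rewrite mulrN mulrBl.
have c2E : E gp gm = - (E gp gp)^*.
  have := SC gp gm; rewrite !EC Egm astar_gp astar_gm !innerZl rmorphD rmorphM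
    /=.
  by rewrite rmorphN /= conjCi opprK -dot_hermC rmorphN /= => /addrI.
exists (E gp gp); split.
  (* [S gp gp = i / 2 + c] is real, which fixes the imaginary part of [c]. *)
  have := SC gp gp; rewrite !EC astar_gp innerZl inner_gp_gp rmorphD rmorphM /=.
  have -> : (2^-1 : R[i])^* = 2^-1 by rewrite fmorphV /= conjC_nat.
  rewrite conjCi; move: (E gp gp) => c E1.
  have -> : c - c^* = (('i / 2 + c) - 'i / 2) - c^* by ring.
  by rewrite E1; field.
move=> f k; rewrite EC ES EgpE c2E.
move: (E gp gp) (_^*) (al k)^* (be k)^* => c c' u v.
by congr (_ + _ * _); ring.
Qed.

Lemma resolvent_equation_pairing (S : bounded_op (Hplus Adot) (Hminus Adot)) z
  f u :
  S f - z *: embed Adot f = u ->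
  forall k, S f k - z * inner (f : H) (k : H) = u k.
Proof. by move=> <-. Qed.

(** The system at [z = i] in scalar terms, with [chi] standing for [K^*]. *)
Lemma lsystem_impedance_i (Th : lsystem Adot) V : is_impedance Th V ->
  exists2 chi : Hplus Adot -> R[i],
    (forall f k, im_op (state_op Th) f k = chi f * (chi k)^*) &
    exists f, (forall k, re_op (state_op Th) f k - 'i * inner (f : H) (k : H) =
      (chi k)^*) /\ V 'i = chi f.
Proof.
have i1 : 'Im ('i : R[i]) != 0 by rewrite Im_i oner_eq0.
move=> /(_ 'i i1)[[f [[fE _] Vf]] _].
exists (channel_adj (channel_op Th)).
  by move=> h k; rewrite lsys_im channel_adjP.
exists f; split=> // k.
move/resolvent_equation_pairing: fE => /(_ k) fE; apply: (etrans fE).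
apply: (etrans (channel_adjP _ _ _)); exact: mul1r.
Qed.

Lemma lsystem_state_op (Th : lsystem Adot) :
  quasi_kernel (re_op (state_op Th)) = A ->
  impedance_coincides Th (fun z => a%:C%C * weyl_titchmarsh A g z) ->
  state_op Th = state1a.
Proof.
move=> qk [V Vimp VE].
have [[[_ AT _ _] _] [BT _] [BT' AT'] [reB _]] := lsys_star Th.
have [c [cC SE]] := biextension_form reB qk.
have im_dom f : AD (f : H, astar f) -> im_op (state_op Th) f = 0.
  move=> Af; rewrite /im_op.
  have -> : ((2 * 'i)^-1 *: (state_op Th - adj_op (state_op Th))) f =
    (2 * 'i)^-1 *: (state_op Th f - adj_op (state_op Th) f) by [].
  by rewrite (bop_extends_dom BT AT Af) (bop_extends_dom BT' AT' Af) subrr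
    scaler0.
have [chi imE [f [fE Vf]]] := lsystem_impedance_i Vimp.
(* The imaginary part vanishes on [Dom(Adot)], and its diagonal value at [k] is [|chi k|^2]. *)
have chi_dom k : AD (k : H, astar k) -> chi k = 0.
  move=> Ak; have := imE k k; rewrite im_dom // -normCK => /esym/eqP.
  by rewrite expf_eq0 normr_eq0 => /eqP.
have i0 : 0 < 'Im ('i : R[i]) by rewrite Im_i ltr01.
have i1 : 'Im ('i : R[i]) != 0 by rewrite gt_eqF.
have Vf' : chi f = a%:C%C * 'i.
  have := VE 'i i0; rewrite (weyl_titchmarshE A_sa i1 g_norm) sqrCi addNr mul0r.
  by rewrite addr0 Vf.
have fi : astar f = 'i *: (f : H).
  apply/eqP; rewrite -subr_eq0; apply/eqP/embed_eq0 => k Ak.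
  have := fE k; rewrite chi_dom // conjC0 SE /= innerBl innerZl.
  by rewrite (defect_coef_gp_dom Ak) (defect_coef_gm_dom Ak) conjC0 !mulr0
    subr0 mulr0 addr0.
have [l lE] : exists l, (f : H) = l *: (gp : H).
  by apply: defect_gp; rewrite -fi; exact: astarP.
have fl : f = l *: gp by exact: val_inj.
have alf : al f = l by rewrite fl defect_coefZ defect_coef_gp_gp mulr1.
have bef : be f = 0 by rewrite fl defect_coefZ defect_coef_gm_gp mulr0.
(* For [f = l gp] the term [A^* f] cancels against [i f]: the channel vector is [l] times
   [omega]. *)
have chiCK k : (chi k)^* = l * (c * (al k)^* - c^* * (be k)^*).
  by rewrite -fE SE fi innerZl alf bef subr0 addrC addKr.
have chiK k : chi k = l^* * (c^* * al k - c * be k).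
  by rewrite -[LHS]conjCK chiCK rmorphM rmorphB !rmorphM /= !conjCK.
have ll : l * l^* * c^* = a%:C%C * 'i.
  by rewrite -Vf' chiK alf bef mulr0 subr0 [c^* * l]mulrC mulrA [l * l^*]mulrC.
have aC : (a%:C%C : R[i])^* = a%:C%C by apply/CrealP; rewrite complex_real.
have ll' : l * l^* * c = - (a%:C%C * 'i).
  by have := congr1 Num.conj ll; rewrite !rmorphM /= !conjCK aC conjCi mulrN
    [l^* * l]mulrC.
have i2 := neq0Ci R[i].
(* The impedance value makes [|l|^2 c] equal to [- a i]; comparison with [c - c^* = - i] gives the
   modulus of [l], then [c] itself. The phase of [l] stays free and drops out of
   [chi f * (chi k)^*]. *)
have l2 : l * l^* = 2 * a%:C%C.
  have : l * l^* * (c - c^*) = - (2 * a%:C%C * 'i).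
    rewrite mulrBr ll ll'; move: (a%:C%C) => b.
    by ring.
  by rewrite cC mulrN => /oppr_inj/(mulIf i2).
have a0 : a%:C%C != 0 :> R[i].
  by rewrite gt_eqF // ltcR (lt_trans ltr01).
have cE : c = - 'i / 2.
  have -> : c = (l * l^* * c) / (2 * a%:C%C) by rewrite l2; field.
  by rewrite ll'; field.
have cCE : c^* = 'i / 2.
  have -> : c^* = (l * l^* * c^*) / (2 * a%:C%C) by rewrite l2; field.
  by rewrite ll; field.
apply: (boundary_form_inj _ boundary_form_state1a) => f1 k.
have -> : state_op Th f1 k =
    re_op (state_op Th) f1 k + 'i * im_op (state_op Th) f1 k.
  have -> : re_op (state_op Th) f1 k =
    2^-1 * (state_op Th f1 k + adj_op (state_op Th) f1 k) by [].
  have -> : im_op (state_op Th) f1 k =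
    (2 * 'i)^-1 * (state_op Th f1 k - adj_op (state_op Th) f1 k) by [].
  move: (state_op Th f1 k) (adj_op _ _ _) => u v.
  by field.
rewrite SE imE chiCK chiK cCE cE.
have -> : p1 = 1 - l * l^* / 2.
  by rewrite l2 (rmorphB (real_complex R)) rmorph1; field.
have -> : q1 = 1 + l * l^* / 2.
  by rewrite l2 (rmorphD (real_complex R)) rmorph1; field.
rewrite rmorphD /=.
have ii : 'i * 'i = -1 :> R[i] by rewrite -expr2 sqrCi.
move: (inner _ _) (al f1) (be f1) (al k)^* (be k)^* (l^*) => t x y u v l'.
by field: ii.
Qed.

(** All other fields are proofs. *)
Lemma lsystem_inj (Th Th' : lsystem Adot) : main_op Th = main_op Th' ->
  state_op Th = state_op Th' -> channel_op Th = channel_op Th' -> Th = Th'.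
Proof.
case: Th Th' => [T B K d1 q1 d2 r1 s1 i1] [T' B' K' d1' q1' d2' r1' s1' i1'] /=.
move=> TT' BB' KK'; rewrite -{}TT' -{}BB' -{}KK' in d1' q1' d2' r1' s1' i1' *.
by congr LSystem; exact: Prop_irrelevance.
Qed.

Lemma main_op_lsystem (Th : lsystem Adot) :
  state_op Th = state1a -> main_op Th = ext p1 q1.
Proof.
move=> ThE; apply: main_op_state1a; first exact: lsys_quasi_self_adjoint.
by have [_ [BT _] _ _] := lsys_star Th; rewrite -ThE.
Qed.

(** * The von Neumann parameters *)

Lemma von_neumann_ext1a :
  von_neumann_main gp gm (ext p1 q1) ((a - 1) / (1 + a))%:C%C.
Proof.
have q0 := q1_neq0.
(* [gp - c gm] has coordinates [(1, - c)], so the boundary condition reads [p1 = - q1 c]. *)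
have kE : q1 * ((a - 1) / (1 + a))%:C%C = - p1.
  rewrite -(rmorphM (real_complex R)) -(rmorphN (real_complex R)) /=.
  congr (_%:C)%C; rewrite mulrC divfK ?opprB //.
  by apply: contra_neq q0 => ->.
have coefE (c : R[i]) : al (gp - c *: gm) = 1 /\ be (gp - c *: gm) = - c.
  rewrite !defect_coefB !defect_coefZ defect_coef_gp_gp defect_coef_gp_gm.
  by rewrite defect_coef_gm_gp defect_coef_gm_gm mulr0 mulr1 subr0 sub0r.
split.
  split.
    rewrite -(ltr_pM2l q1_gt0) mulr1 -{1}(gtr0_norm q1_gt0) -normrM kE normrN.
    exact: norm_p1_lt.
  exists (astar (gp - ((a - 1) / (1 + a))%:C%C *: gm)).
  exists (gp - ((a - 1) / (1 + a))%:C%C *: gm); split=> //.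
  by have [-> ->] := coefE ((a - 1) / (1 + a))%:C%C;
    rewrite mulr1 mulrN kE opprK.
move=> c [_ [y [f [/= fx _]]]].
have -> : f = gp - c *: gm by exact: val_inj.
have [-> ->] := coefE c; rewrite mulr1 mulrN => E.
by apply: (mulfI q0); rewrite kE E opprK.
Qed.

Lemma von_neumann_ext11 : von_neumann_self_adjoint gp gm (ext 1 1) 1.
Proof.
have coefE (c : R[i]) : al (gp + c *: gm) = 1 /\ be (gp + c *: gm) = c.
  rewrite !defect_coefD !defect_coefZ defect_coef_gp_gp defect_coef_gp_gm.
  by rewrite defect_coef_gm_gp defect_coef_gm_gm mulr0 mulr1 addr0 add0r.
split.
  split; first exact: normr1.
  exists (astar (gp + 1 *: gm)), (gp + 1 *: gm); split=> //.
  by have [-> ->] := coefE 1.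
move=> c [_ [y [f [/= fx _]]]].
have -> : f = gp + c *: gm by exact: val_inj.
by have [-> ->] := coefE c; rewrite !mul1r.
Qed.

Lemma lsystem1a_realizes :
  [/\ unique (fun Th : lsystem Adot =>
        [/\ state_op Th = state1a, channel_op Th = channel_of chi1a &
            impedance_coincides Th
              (fun z => a%:C%C * weyl_titchmarsh A g z)]) lsystem1a,
      von_neumann_main gp gm (main_op lsystem1a) ((a - 1) / (1 + a))%:C%C,
      quasi_kernel (re_op (state_op lsystem1a)) = A &
      von_neumann_self_adjoint gp gm
        (quasi_kernel (re_op (state_op lsystem1a))) 1].
Proof.
have qkE : quasi_kernel (re_op (state_op lsystem1a)) = ext 1 1.
  exact: quasi_kernel_boundary boundary_form_re1a.
split.
- split=> [|Th [ThB ThK _]].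
    split=> //; exists
      (fun z => a%:C%C * (z + (z ^+ 2 + 1) * inner (resolvent A z g) g)).
      exact: is_impedance1a.
    by move=> z z0; rewrite (weyl_titchmarshE A_sa) // gt_eqF.
  (* State-space and channel operators are prescribed, and the former determines the main
     operator. *)
  apply: lsystem_inj; [|exact: esym ThB|exact: esym ThK].
  by rewrite (main_op_lsystem ThB).
- exact: von_neumann_ext1a.
- by rewrite qkE -A_E.
- by rewrite qkE; exact: von_neumann_ext11.
Qed.

Lemma lsystem_von_neumann (Th : lsystem Adot) :
  quasi_kernel (re_op (state_op Th)) = A ->
  impedance_coincides Th (fun z => a%:C%C * weyl_titchmarsh A g z) ->
  von_neumann_main gp gm (main_op Th) ((a - 1) / (1 + a))%:C%C /\
  von_neumann_self_adjoint gp gm (quasi_kernel (re_op (state_op Th))) 1.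
Proof.
move=> qk imp; rewrite (main_op_lsystem (lsystem_state_op qk imp)) qk A_E.
by split; [exact: von_neumann_ext1a|exact: von_neumann_ext11].
Qed.

End Operators.

End Extensions.

Theorem theorem8 (R : realType) (H : hilbertType R) (Adot : csym_operator H)
  (Adot_defi : deficiency_indices Adot 1 1)
  (gp gm : Hplus Adot)
  (gp_defect : defect_space Adot 'i gp)
  (gm_defect : defect_space Adot (- 'i) gm)
  (gp_norm : `|gp| = 1) (gm_norm : `|gm| = 1)
  (Rz : Hminus Adot -> Hplus Adot) (Rz_rb : riesz_berezansky Rz)
  (phi psi : Hminus Adot) (phiE : Rz phi = gp) (psiE : Rz psi = gm)
  (A : set (H * H)) (A_sa : self_adjoint A) (A_ext : csym_graph Adot `<=` A)
  (A_dom : opdom A ((gp : H) + (gm : H)))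
  (g : H) (g_defect : defect_space Adot 'i g) (g_norm : `|g| = 1)
  (a : R) (a_gt1 : 1 < a) :
  let aM := fun z : R[i] => (a%:C)%C * weyl_titchmarsh A g z in
  let A1a : bounded_op (Hplus Adot) (Hminus Adot) :=
    star_op Adot
      - ('i / 2) *: rank1 (((1 - a)%:C)%C *: phi - ((1 + a)%:C)%C *: psi)
                          (phi + psi) in
  let chi1a : Hminus Adot := ((Num.sqrt (a / 2))%:C)%C *: (phi + psi) in
  let K1a : bounded_op R[i]^o (Hminus Adot) := channel_of chi1a in
  let kappa : R[i] := (((a - 1) / (1 + a))%:C)%C in
  (exists Th : lsystem Adot,
    [/\ unique (fun Th' : lsystem Adot =>
          [/\ state_op Th' = A1a, channel_op Th' = K1a &
              impedance_coincides Th' aM]) Th,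
        von_neumann_main gp gm (main_op Th) kappa,
        quasi_kernel (re_op (state_op Th)) = A &
        von_neumann_self_adjoint gp gm
          (quasi_kernel (re_op (state_op Th))) 1]) /\
  (forall Th : lsystem Adot,
    quasi_kernel (re_op (state_op Th)) = A ->
    impedance_coincides Th aM ->
    von_neumann_main gp gm (main_op Th) kappa /\
    von_neumann_self_adjoint gp gm (quasi_kernel (re_op (state_op Th))) 1).
Proof.
(* The Riesz-Berezansky pairing turns [phi] and [psi] into the conjugated boundary coordinates. *)
have coefE (u : Hminus Adot) e : Rz u = e ->
    forall f, u f = (defect_coef e f)^*.
  move=> <- f; rewrite defect_coefE -(rb_pairing Rz_rb).
  by rewrite /pairing conjCK.
have phiC := coefE _ _ phiE; have psiC := coefE _ _ psiE.
split.
  exists (lsystem1a Adot_defi gp_defect gm_defect gp_norm gm_norm phiC psiC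
    a_gt1 A_sa A_ext A_dom).
  exact: lsystem1a_realizes.
exact: (lsystem_von_neumann Adot_defi gp_defect gm_defect gp_norm gm_norm
  phiC psiC a_gt1 A_sa A_ext A_dom g_norm).
Qed.
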